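(* Let $D\subset\mathbb{C}^n$ be a domain containing the origin $O$. Let $\mathcal{S}_1=\{\varphi_t\}_{t\ge 0}$ and $\mathcal{S}_2=\{\psi_t\}_{t\ge 0}$ be two one-parameter continuous semigroups of holomorphic self-mappings of $D$ generated by mappings $f_1$ and $f_2$, respectively, with $f_1(O)=f_2(O)=O$. Suppose that $d(f_1)_O=d(f_2)_O=A$, where every eigenvalue of $A$ has negative real part, and that there exists $s_0>0$ such that (i) $\psi_{s_0}$ is uniquely linearizable, and (ii) $\psi_{s_0}\circ\varphi_t=\varphi_t\circ\psi_{s_0}$ for all $t\ge 0$. Then the semigroups coincide, i.e. $\varphi_t=\psi_t$ for all $t\ge 0$.
   Context: A one-parameter continuous semigroup on a domain $D\subset\mathbb{C}^n$ is a family $\{\varphi_t\}_{t\ge 0}$ of holomorphic maps $\varphi_t:D\to D$ with $\varphi_{t+s}=\varphi_t\circ\varphi_s$ for all $s,t\ge 0$ and $\lim_{t\to 0^+}\varphi_t(z)=z$ for all $z\in D$. Its generator is the holomorphic map $f:D\to\mathbb{C}^n$, $f(z)=\lim_{t\to 0^+}\frac{\varphi_t(z)-z}{t}$. For a holomorphic map $g$, $dg_z$ denotes its (complex) Fréchet derivative at $z$. A holomorphic map $h:D\to\mathbb{C}^n$ is called biholomorphic if it is biholomorphic onto its image $h(D)$. A holomorphic map $\psi:D\to D$ is uniquely linearizable if there is a unique biholomorphic map $h:D\to\mathbb{C}^n$ normalized by $h(O)=O$, $dh_O=\mathrm{id}$, such that $h\circ\psi=B\circ h$ for some linear operator $B$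 on $\mathbb{C}^n$ (by the chain rule then $B=d\psi_O$). *)

(* Defs.v *)
From HB Require Import structures.
From mathcomp Require Import all_boot all_order all_algebra complex.
From mathcomp Require Import all_classical all_reals all_analysis.

Set Implicit Arguments.
Unset Strict Implicit.
Unset Printing Implicit Defensive.

Import Order.TTheory GRing.Theory Num.Theory.
Import numFieldNormedType.Exports.

Local Open Scope classical_set_scope.
Local Open Scope ring_scope.
Local Open Scope complex_scope.

(* MathComp-Analysis puts its norm topology on R[i] only through the structure  *)
(* [numFieldType]; the same instances are made canonical on R[i] itself.        *)
HB.instance Definition _ (R : rcfType) := GRing.ComAlgebra.copy R[i] R[i]^o.
HB.instance Definition _ (R : rcfType) := Vector.copy R[i] R[i]^o.
HB.instance Definition _ (R : rcfType) := NormedModule.copy R[i] R[i]^o.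

(* C^n is the normed space ['rV[R[i]]_n] over the complex field [R[i]], so      *)
(* [differentiable] is complex Frechet differentiability.  Linear operators act *)
(* on row vectors on the right: [v *m 'J f z] is the derivative of f at z,      *)
(* applied to v.                                                                *)
(* A map defined on a domain D is a total function whose values outside D are   *)
(* irrelevant: D is open, so the definitions below only depend on its           *)
(* restriction to D.                                                            *)

Definition domain (R : realType) (n : nat) (D : set 'rV[R[i]]_n) : Prop :=
  [/\ open D, connected D & D !=set0].

Definition holomorphic (R : realType) (n : nat) (D : set 'rV[R[i]]_n)
    (f : 'rV[R[i]]_n -> 'rV[R[i]]_n) : Prop :=
  forall z, D z -> differentiable f z.

Definition holomorphic_self_map (R : realType) (n : nat)
    (D : set 'rV[R[i]]_n) (f : 'rV[R[i]]_n -> 'rV[R[i]]_n) : Prop :=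
  holomorphic D f /\ (forall z, D z -> D (f z)).

(* Biholomorphic onto its image. *)
Definition biholomorphic (R : realType) (n : nat) (D : set 'rV[R[i]]_n)
    (h : 'rV[R[i]]_n -> 'rV[R[i]]_n) : Prop :=
  [/\ holomorphic D h, open (h @` D) &
      exists2 g : 'rV[R[i]]_n -> 'rV[R[i]]_n,
        holomorphic (h @` D) g & forall z, D z -> g (h z) = z].

(* Only the maps [phi t] with [0 <= t] matter. *)
Definition continuous_semigroup (R : realType) (n : nat)
    (D : set 'rV[R[i]]_n) (phi : R -> 'rV[R[i]]_n -> 'rV[R[i]]_n) : Prop :=
  [/\ forall t : R, 0 <= t -> holomorphic_self_map D (phi t),
      forall s t : R, 0 <= s -> 0 <= t ->
        forall z, D z -> phi (t + s) z = phi t (phi s z) &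
      forall z, D z -> phi t z @[t --> 0^'+] --> z].

Definition generator (R : realType) (n : nat) (D : set 'rV[R[i]]_n)
    (phi : R -> 'rV[R[i]]_n -> 'rV[R[i]]_n)
    (f : 'rV[R[i]]_n -> 'rV[R[i]]_n) : Prop :=
  holomorphic D f /\
  forall z, D z -> t^-1%:C *: (phi t z - z) @[t --> 0^'+] --> f z.

Definition normalized_linearization (R : realType) (n : nat)
    (D : set 'rV[R[i]]_n) (psi h : 'rV[R[i]]_n -> 'rV[R[i]]_n) : Prop :=
  [/\ biholomorphic D h, h 0 = 0, 'J h 0 = 1%:M &
      exists B : 'M[R[i]]_n, forall z, D z -> h (psi z) = h z *m B].

(* Uniqueness is that of the restriction to D. *)
Definition uniquely_linearizable (R : realType) (n : nat)
    (D : set 'rV[R[i]]_n) (psi : 'rV[R[i]]_n -> 'rV[R[i]]_n) : Prop :=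
  exists h : 'rV[R[i]]_n -> 'rV[R[i]]_n,
    normalized_linearization D psi h /\
    (forall h', normalized_linearization D psi h' ->
       forall z, D z -> h' z = h z).

(* Main.v *)
Require Import Defs.
From HB Require Import structures.
From mathcomp Require Import all_boot all_order all_algebra complex.
From mathcomp Require Import all_classical all_reals all_analysis.
From mathcomp Require Import ring lra.

Set Implicit Arguments.
Unset Strict Implicit.
Unset Printing Implicit Defensive.

Import Order.TTheory GRing.Theory Num.Theory.
Import numFieldNormedType.Exports.

Local Open Scope classical_set_scope.
Local Open Scope ring_scope.
Local Open Scope complex_scope.

(** Let [h] be the unique normalized linearization of [psi s0].  The map [phi t]
    is univalent and fixes 0, so, with [M := 'J (phi t) 0], the map
    [z |-> h (phi t z) *m invmx M] is again biholomorphic and normalized; as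
    [phi t] commutes with [psi s0], it linearizes [psi s0] as well.  Uniqueness
    forces it to be [h], that is, [h (phi t z) = h z *m M]
    ([linearizes_commuting_flow]).  The semigroup law makes [psi t] commute with
    [psi s0], so [psi t] is linearized by [h] in the same way.  Near 0 the
    trajectories of both semigroups solve [u' = f u] for vector fields with the
    same linear part, hence [phi t] and [psi t] have the same derivative at 0 for
    small [t] ([flows_tangent], [flows_same_jacobian]).  Thus
    [h (phi t z) = h (psi t z)], so [phi t z = psi t z] for small [t], and the
    semigroup law extends the equality to all [t].

    The substance is the univalence of [phi t], which has to be extracted from
    very little: trajectories are only right continuous at time 0, and
    holomorphy is only pointwise complex differentiability.

    - A right continuous function has continuity points in every interval, and
      the semigroup law transports one such point to all later times, so
      trajectories are continuous ([flow_cont]); they have right derivative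
      [f (phi t z)] everywhere ([flow_right_deriv]).
    - The generator is locally Lipschitz ([holomorphic_lipschitz]).  This is
      the one place where complex analysis enters: it follows from Cauchy's
      estimate for the derivative on complex lines ([cauchy_estimate]), which is
      obtained from Goursat's theorem for rectangles ([goursat]).
    - Consequently, for short times and locally uniformly, [phi t] differs from
      the identity by a contraction ([flow_near_id]); such a map is injective,
      and the iteration of Banach's fixed point theorem makes it open with linear
      control ([linearly_open_near_id]).
    - Injectivity and linear openness are carried along each trajectory to all
      times by induction over a real interval ([flow_injective],
      [flow_linearly_open]).  An injective, linearly open holomorphic map has
      invertible derivatives and a holomorphic inverse
      ([linearly_open_jacobian_unit], [linearly_open_biholo]). *)


(** * The norm as a real number, and differentiability with epsilons and deltas *)

Section Rnorm.
Variable R : realType.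

(** The norm of a module normed over [R[i]] is itself an element of [R[i]]; being
    real, it carries the same information as its real part, with which ordered
    field arithmetic in [R] is possible. *)
Definition rnorm (V : normedZmodType R[i]) (x : V) : R := complex.Re `|x|.

Lemma normr_rnorm (V : normedZmodType R[i]) (x : V) : `|x| = (rnorm x)%:C.
Proof.
rewrite /rnorm; have := normr_ge0 x; case: `|x| => a b; rewrite lecE /=.
by case/andP => /eqP -> _.
Qed.

Lemma rnorm_ge0 (V : normedZmodType R[i]) (x : V) : 0 <= rnorm x.
Proof. by have := normr_ge0 x; rewrite normr_rnorm lecR. Qed.

Lemma rnormD (V : normedZmodType R[i]) (x y : V) : rnorm (x + y) <= rnorm x + rnorm y.
Proof. by have := ler_normD x y; rewrite !normr_rnorm -rmorphD lecR. Qed.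

Lemma rnormN (V : normedZmodType R[i]) (x : V) : rnorm (- x) = rnorm x.
Proof. by rewrite /rnorm normrN. Qed.

Lemma rnormB (V : normedZmodType R[i]) (x y : V) : rnorm (x - y) = rnorm (y - x).
Proof. by rewrite /rnorm distrC. Qed.

Lemma rnorm_triangle (V : normedZmodType R[i]) (y x z : V) :
  rnorm (x - z) <= rnorm (x - y) + rnorm (y - z).
Proof. by have := rnormD (x - y) (y - z); rewrite addrA subrK. Qed.

Lemma rnorm0 (V : normedZmodType R[i]) : rnorm (0 : V) = 0.
Proof. by rewrite /rnorm normr0. Qed.

Lemma rnorm_eq0 (V : normedZmodType R[i]) (x : V) : rnorm x <= 0 -> x = 0.
Proof.
move=> x0; apply/eqP; rewrite -normr_eq0 normr_rnorm eq_complex /= eqxx andbT.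
by rewrite eq_le x0 rnorm_ge0.
Qed.

Lemma rnorm_gt0 (V : normedZmodType R[i]) (x : V) : x != 0 -> 0 < rnorm x.
Proof.
by apply: contraNT; rewrite -leNgt => /rnorm_eq0 ->.
Qed.

Lemma rnormZ (V : normedModType R[i]) (a : R[i]) (x : V) :
  rnorm (a *: x) = rnorm a * rnorm x.
Proof. by have := normrZ a x; rewrite !normr_rnorm -rmorphM => -[]. Qed.

Lemma rnormM (a b : R[i]) : rnorm (a * b) = rnorm a * rnorm b.
Proof. by have := normrM a b; rewrite !normr_rnorm -rmorphM => -[]. Qed.

Lemma rnormR (a : R) : rnorm (a%:C) = `|a|.
Proof. by rewrite /rnorm normc_def /= expr0n /= addr0 sqrtr_sqr. Qed.

Lemma rnorm1 : rnorm (1 : R[i]) = 1.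
Proof. by have := rnormR 1; rewrite normr1. Qed.

Lemma rnormV (a : R[i]) : a != 0 -> rnorm a^-1 = (rnorm a)^-1.
Proof.
move=> a0; have na := rnorm_gt0 a0.
by apply: (mulIf (lt0r_neq0 na)); rewrite -rnormM !mulVf ?rnorm1 // gt_eqF.
Qed.

Lemma rnorm_i : rnorm (0 +i* 1 : R[i]) = 1.
Proof. by rewrite /rnorm normc_def /= expr0n expr1n /= add0r sqrtr1. Qed.

Lemma Re_le_rnorm (a : R[i]) : `|complex.Re a| <= rnorm a.
Proof. by have := normc_ge_Re a; rewrite normr_rnorm lecR. Qed.

Lemma rnorm_le_ReIm (a : R[i]) : rnorm a <= `|complex.Re a| + `|complex.Im a|.
Proof.
rewrite {1}(complexE a) (le_trans (rnormD _ _)) // rnormM rnormR.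
by rewrite lerD // rnormR ler_piMl // rnorm_i.
Qed.

Lemma Im_le_rnorm (a : R[i]) : `|complex.Im a| <= rnorm a.
Proof.
case: a => x y; rewrite /rnorm normc_def /=.
by rewrite -(sqrtr_sqr y) ler_wsqrtr // lerDr sqr_ge0.
Qed.

Lemma nbhs_rnorm (V : normedModType R[i]) (x : V) (P : set V) :
  nbhs x P <-> exists2 e : R, 0 < e & forall y, rnorm (y - x) < e -> P y.
Proof.
split.
  move/nbhs_normP => [e /= e0 eP].
  exists (complex.Re e); first by move: e0; case: e {eP} => a b; rewrite ltcE /= => /andP[].
  move=> y yx; apply: eP => /=; rewrite distrC normr_rnorm.
  move: e0 yx; case: e => a b; rewrite !ltcE /= => /andP[/eqP -> _].
  by rewrite eqxx.
move=> [e e0 eP]; apply/nbhs_normP; exists e%:C => /=; first by rewrite ltcR.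
by move=> y /=; rewrite distrC normr_rnorm ltcR; exact: eP.
Qed.

Lemma cvg_rnorm (T : Type) (F : set_system T) {FF : Filter F} (V : normedModType R[i])
    (f : T -> V) (l : V) :
  (f t @[t --> F] --> l) <-> forall e : R, 0 < e -> \forall t \near F, rnorm (f t - l) < e.
Proof.
split => [fl e e0|H].
  apply: (fl [set y | rnorm (y - l) < e]).
  by apply/nbhs_rnorm; exists e.
move=> P /nbhs_rnorm[e e0 eP]; rewrite /nbhs /=.
by apply: filterS (H e e0) => t; exact: eP.
Qed.

Lemma cvg_right0 (V : normedModType R[i]) (f : R -> V) (l : V) :
  f t @[t --> 0^'+] --> l -> forall e : R, 0 < e ->
  exists2 d : R, 0 < d & forall t, 0 < t -> t < d -> rnorm (f t - l) < e.
Proof.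
move/cvg_rnorm => H e e0; have := H e e0; case/nbhs_ballP => d /= d0 dP.
exists d => // t t0 td; apply: dP => //=.
by rewrite /ball /= sub0r normrN gtr0_norm.
Qed.

Lemma rnorm_entry n (v : 'rV[R[i]]_n) j : rnorm (v 0 j) <= rnorm v.
Proof.
have : `|v 0 j| <= `|v|.
  rewrite [leRHS]mx_normE -[leLHS]nngE num_le.
  exact: (le_bigmax _ (fun p : 'I_1 * 'I_n => `|v p.1 p.2|%:nng) (0, j)).
by rewrite !normr_rnorm lecR.
Qed.

Lemma rnorm_row_le n (v : 'rV[R[i]]_n) (M : R) : 0 <= M ->
  (forall j, rnorm (v 0 j) <= M) -> rnorm v <= M.
Proof.
move=> M0 H; have : `|v| <= M%:C.
  have M0' : 0 <= M%:C by rewrite lecR.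
  rewrite [leLHS]mx_normE -[leRHS]/((NngNum M0')%:num) num_le.
  apply/bigmax_leP; split => [|[i j] _]; rewrite -num_le //=.
  by rewrite ord1 normr_rnorm lecR.
by rewrite normr_rnorm lecR.
Qed.

Lemma rnorm_mulmx n m (A : 'M[R[i]]_(n, m)) :
  exists2 L : R, 0 < L & forall v : 'rV[R[i]]_n, rnorm (v *m A) <= L * rnorm v.
Proof.
exists (1 + \sum_i \sum_j rnorm (A i j)).
  rewrite ltr_pwDl // sumr_ge0 // => i _; rewrite sumr_ge0 // => j _.
  exact: rnorm_ge0.
move=> v; apply: rnorm_row_le.
  rewrite mulr_ge0 ?rnorm_ge0 // addr_ge0 // sumr_ge0 // => i _.
  by rewrite sumr_ge0 // => j _; exact: rnorm_ge0.
move=> j; rewrite mxE.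
apply: (@le_trans _ _ (\sum_i rnorm (v 0 i * A i j))).
  elim/big_ind2 : _ => //; first by rewrite rnorm0.
  by move=> x1 x2 y1 y2 h1 h2; exact: le_trans (rnormD _ _) (lerD h1 h2).
apply: (@le_trans _ _ (\sum_i rnorm (A i j) * rnorm v)).
  apply: ler_sum => i _; rewrite rnormM mulrC ler_wpM2l ?rnorm_ge0 //.
  exact: rnorm_entry.
rewrite -mulr_suml ler_wpM2r ?rnorm_ge0 //.
apply: (@le_trans _ _ (\sum_i \sum_j rnorm (A i j))); last by rewrite lerDr.
apply: ler_sum => i _; rewrite (bigD1 j) //= lerDl sumr_ge0 // => k _.
exact: rnorm_ge0.
Qed.

Lemma differentiable_rnorm n m (f : 'rV[R[i]]_n -> 'rV[R[i]]_m) z :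
  differentiable f z -> forall e : R, 0 < e -> exists2 d : R, 0 < d &
  forall v, rnorm v < d ->
    rnorm (f (z + v) - f z - v *m 'J f z) <= e * rnorm v.
Proof.
move=> /diff_locallyP[_ /eqaddoP H] e e0.
have e0' : 0 < e%:C by rewrite ltcR.
have /nbhs_rnorm[d d0 dP] := H _ e0'.
exists d => // v vd; have := dP v; rewrite subr0 => /(_ vd) /=.
rewrite mul_rV_lin1 !normr_rnorm -rmorphM lecR !fctE /= [v + z]addrC.
by rewrite opprD addrA.
Qed.

(** A first-order expansion identifies the Jacobian, so that differentiability
    and the value of ['J] can be established together from an estimate. *)
Lemma rnorm_differentiable n m (f : 'rV[R[i]]_n -> 'rV[R[i]]_m) z A :
  (forall e : R, 0 < e -> exists2 d : R, 0 < d &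
  forall v, rnorm v < d ->
    rnorm (f (z + v) - f z - v *m A) <= e * rnorm v) ->
  differentiable f z /\ 'J f z = A.
Proof.
move=> H.
have cA : continuous (mulmxr A : 'rV[R[i]]_n -> 'rV[R[i]]_m).
  move=> x; apply/(@cvg_rnorm _ (nbhs x) (nbhs_filter x)) => e e0.
  have [L L0 HL] := rnorm_mulmx A.
  apply/nbhs_rnorm; exists (e / L); first exact: divr_gt0.
  move=> y yx; rewrite /= -mulmxBl (le_lt_trans (HL _)) //.
  by rewrite mulrC -ltr_pdivlMr.
have oA : f \o shift z = cst (f z) + (mulmxr A : 'rV[R[i]]_n -> 'rV[R[i]]_m) +o_ 0 id.
  apply/eqaddoP => e e0.
  have re0 : 0 < complex.Re e by move: e0; case: e => a b; rewrite ltcE /= => /andP[].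
  have ee : e = (complex.Re e)%:C.
    by move: e0 {re0}; case: e => a b; rewrite ltcE /= => /andP[/eqP -> _].
  have [d d0 dP] := H _ re0.
  apply/nbhs_rnorm; exists d => // v; rewrite subr0 => vd.
  rewrite ee !normr_rnorm -rmorphM lecR !fctE /= [v + z]addrC opprD addrA.
  exact: dP.
have dA := diff_unique cA oA; split.
  by apply/diff_locallyP; rewrite dA.
apply/row_matrixP => i; rewrite !rowE mul_rV_lin1.
by rewrite dA.
Qed.

Lemma rnorm_continuous n m (f : 'rV[R[i]]_n -> 'rV[R[i]]_m) z :
  differentiable f z -> forall e : R, 0 < e -> exists2 d : R, 0 < d &
  forall w, rnorm (w - z) < d -> rnorm (f w - f z) < e.
Proof.
move=> /differentiable_continuous/cvg_rnorm H e e0.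
by have /nbhs_rnorm[d d0 dP] := H _ e0; exists d.
Qed.

Lemma differentiable_lipschitz_at n (g : 'rV[R[i]]_n -> 'rV[R[i]]_n) z : differentiable g z ->
  exists2 L : R, 0 < L & exists2 d : R, 0 < d &
    forall w, rnorm (w - z) < d -> rnorm (g w - g z) <= L * rnorm (w - z).
Proof.
move=> dg; have [L L0 LP] := rnorm_mulmx ('J g z).
have [d d0 dP] := differentiable_rnorm dg ltr01.
exists (1 + L); first by rewrite ltr_pwDl // ltW.
exists d => // w /dP; rewrite [z + _]addrC subrK mul1r => h.
have -> : g w - g z = (g w - g z - (w - z) *m 'J g z) + (w - z) *m 'J g z.
  by rewrite subrK.
rewrite (le_trans (rnormD _ _)) // mulrDl mul1r lerD //.
Qed.


End Rnorm.

(** * Induction over a real interval and one-sided derivative bounds *)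

(** The supremum of the times up to which [P] holds can be neither less than [b],
    by the right step, nor missed, by the left step. *)
Lemma real_induction (R : realType) (P : R -> Prop) (a b : R) :
  P a ->
  (forall t, a <= t -> t < b -> (forall s, a <= s -> s <= t -> P s) ->
    exists2 d : R, 0 < d & forall s, t < s -> s < t + d -> P s) ->
  (forall t, a < t -> t <= b -> (forall s, a <= s -> s < t -> P s) -> P t) ->
  forall t, a <= t -> t <= b -> P t.
Proof.
move=> Pa Pright Pleft t0 at0 t0b.
pose S := [set t | [/\ a <= t, t <= b & forall s, a <= s -> s <= t -> P s]].
have Sa : S a.
  split; [exact: lexx|exact: le_trans t0b|].
  by move=> s as_ sa; have -> : s = a by apply/eqP; rewrite eq_le sa.
have hS : has_sup S.
  by split; [exists a | exists b => t [_ tb _]].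
have [_ ubS] := hS.
set m := sup S.
have am : a <= m by apply: (ub_le_sup ubS); exact: Sa.
have mb : m <= b by apply: ge_sup => // [|t [_ tb _]] //; exists a.
have below s : a <= s -> s < m -> P s.
  move=> as_ /(sup_gt (ex_intro _ a Sa))[t [_ _ tP] st].
  by apply: tP => //; exact: ltW.
have Pm : P m.
  have [<-//|am'] := eqVneq a m.
  by apply: Pleft => //; rewrite lt_neqAle am'.
have below' s : a <= s -> s <= m -> P s.
  move=> as_; rewrite le_eqVlt => /orP[/eqP -> //|]; exact: below.
have [mb'|bm] := ltP m b; last by apply: below' => //; exact: le_trans bm.
have [d d0 dP] := Pright m am mb' below'.
pose t1 := Num.min b (m + d / 2).
have mt1 : m < t1 by rewrite lt_min mb' ltrDl divr_gt0.
have : S t1.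
  split; [exact: le_trans am (ltW mt1)|by rewrite ge_min lexx|].
  move=> s as_ st1; have [sm|ms] := leP s m; first exact: below'.
  apply: dP => //; apply: le_lt_trans st1 _.
  by rewrite /t1 gt_min; apply/orP; right; rewrite ltrD2l; lra.
by move=> St1; have := ub_le_sup ubS St1; rewrite -/m leNgt mt1.
Qed.

Section Trapping.
Variables (R : realType) (V : normedZmodType R[i]).
Implicit Types (w : R -> V).

(** Continuity relative to the interval, so that nothing is asked of [w]
    outside it. *)
Definition cont_on (w : R -> V) (a b : R) := forall t, a <= t -> t <= b ->
  forall e : R, 0 < e -> exists2 d : R, 0 < d &
  forall s, a <= s -> s <= b -> `|s - t| < d -> rnorm (w s - w t) < e.

(** A mean value inequality with a bootstrap: the speed bound [k] is only needed
    as long as [w] has not yet escaped from the cone that it implies.  This is how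
    a local bound on a vector field confines its trajectories. *)
Lemma trapping w (a b k : R) : cont_on w a b ->
  (forall t, a <= t -> t < b -> rnorm (w t - w a) <= k * (t - a) ->
    exists2 d : R, 0 < d & forall s, 0 < s -> s < d ->
      rnorm (w (t + s) - w t) <= k * s) ->
  forall t, a <= t -> t <= b -> rnorm (w t - w a) <= k * (t - a).
Proof.
move=> cw H; apply: real_induction.
- by rewrite !subrr rnorm0 mulr0.
- move=> t at_ tb Ht; have [d d0 dP] := H t at_ tb (Ht t at_ (lexx t)).
  exists d => // s ts std.
  have := dP (s - t); rewrite subr_gt0 ltrBlDl [t + (s - t)]addrC subrK.
  move=> /(_ ts std) h.
  rewrite (le_trans (rnorm_triangle (w t) _ _)) //.
  have := Ht t at_ (lexx t); nra.
- move=> t at_ tb Ht.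
  apply/ler_addgt0Pr => e e0.
  have e20 : 0 < e / 2 by rewrite divr_gt0.
  have [d d0 dP] := cw t (ltW at_) tb _ e20.
  pose k' := `|k| + 1.
  have k'0 : 0 < k' by rewrite ltr_pwDr.
  pose d' := Num.min (Num.min d (e / 2 / k')) (t - a).
  have d'0 : 0 < d' by rewrite !lt_min d0 !divr_gt0 //= subr_gt0.
  pose s := t - d' / 2.
  have d'1 : d' <= d by rewrite /d' !ge_min lexx.
  have d'2 : d' <= e / 2 / k' by rewrite /d' !ge_min lexx orbT.
  have d'3 : d' <= t - a by rewrite /d' !ge_min lexx !orbT.
  have as_ : a <= s by rewrite /s; lra.
  have st : s < t by rewrite /s; lra.
  have := dP s as_ (le_trans (ltW st) tb).
  rewrite ltr0_norm; last by rewrite subr_lt0.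
  have -> : - (s - t) < d by rewrite /s; lra.
  move=> /(_ isT) h1; have h2 := Ht s as_ st.
  have h3 : rnorm (w t - w a) <= rnorm (w s - w t) + rnorm (w s - w a).
    by rewrite [rnorm (w s - w t)]rnormB rnorm_triangle.
  have h4 : k * (s - t) <= e / 2.
    have : d' * k' <= e / 2 by rewrite -ler_pdivlMr.
    have : k * (s - t) <= k' * d'.
      have kk : 0 <= (`|k| + k) * d'.
        rewrite mulr_ge0 ?(ltW d'0) // -lerBlDr sub0r.
        by have := ler_norm (- k); rewrite normrN.
      have k0 : 0 <= `|k| * d' by rewrite mulr_ge0 ?(ltW d'0).
      have -> : s - t = - (d' / 2) by rewrite /s addrAC subrr add0r.
      move: kk k0 d'0; rewrite /k' !mulrDl mulrN; lra.
    lra.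
  lra.
Qed.

(** Trapping with slope [k + e] for every positive [e]; the slack absorbs the
    error term of a right derivative of norm at most [k]. *)
Lemma dini_bound w (a b k : R) : cont_on w a b ->
  (forall t, a <= t -> t < b -> forall e : R, 0 < e ->
    exists2 d : R, 0 < d & forall s, 0 < s -> s < d ->
      rnorm (w (t + s) - w t) <= (k + e) * s) ->
  forall t, a <= t -> t <= b -> rnorm (w t - w a) <= k * (t - a).
Proof.
move=> cw H t at_ tb; apply/ler_addgt0Pr => e e0.
pose e' := e / (t - a + 1).
have ta : 0 < t - a + 1 by rewrite ltr_wpDl ?subr_ge0.
have e'0 : 0 < e' by rewrite divr_gt0.
have := @trapping w a b (k + e') cw _ t at_ tb.
have ee : e' * (t - a + 1) = e by rewrite /e' divfK ?gt_eqF.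
move=> h; apply: le_trans (h _) _; first by move=> u au ub _; exact: H.
nra.
Qed.
End Trapping.

(** * Primitives of continuous complex-valued functions *)

Section Primitive.
Variable R : realType.

Lemma continuous_primitive (f : R -> R) (a b : R) : continuous f -> a < b ->
  exists F : R -> R, forall x, a <= x -> x <= b -> forall e : R, 0 < e ->
  exists2 d : R, 0 < d & forall y, `|y - x| < d ->
    `|F y - F x - (y - x) * f x| <= e * `|y - x|.
Proof.
move=> cf ab.
have fi : (@lebesgue_measure R).-integrable `[a - 1, b + 1] (EFin \o f).
  apply: continuous_compact_integrable; first exact: segment_compact.
  exact: continuous_subspaceT.
pose F (y : R) := \int[@lebesgue_measure R]_(t in `[a - 1, y]) f t.
exists F => x ax xb e e0.
have ax' : a - 1 < x by lra.
have xb' : x < b + 1 by lra.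
have [dF F'] := continuous_FTC1_closed xb' fi ax' (cf x).
have : h^-1 *: (F (h *: 1 + x) - F x) @[h --> 0^'] --> f x.
  by rewrite -F' -/F derive1E; exact: dF.
move=> /cvgrPdist_le /(_ e e0); case/nbhs_ballP => d /= d0 dP.
exists d => // y yx.
have [->|yx0] := eqVneq y x; first by rewrite !subrr mul0r subrr normr0 mulr0.
have := dP (y - x); rewrite /ball /= sub0r normrN => /(_ yx).
have yx1 : y - x != 0 by rewrite subr_eq0.
move=> /(_ yx1) /=; rewrite [_ *: 1]mulr1 subrK => h.
have -> : F y - F x - (y - x) * f x = - ((f x - (y - x)^-1 * (F y - F x)) * (y - x)).
  by field.
by rewrite normrN normrM ler_wpM2r.
Qed.

(** The derivative is taken relative to the interval, one-sided at its ends. *)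
Definition is_primitive (P c : R -> R[i]) (a b : R) := forall x, a <= x -> x <= b ->
  forall e : R, 0 < e -> exists2 d : R, 0 < d &
  forall y, a <= y -> y <= b -> `|y - x| < d ->
    rnorm (P y - P x - (y - x)%:C * c x) <= e * `|y - x|.

(** Composing with the retraction of the line onto [[a, b]] makes the real and
    imaginary parts continuous everywhere; the fundamental theorem of calculus
    then applies to each of them. *)
Lemma cont_on_primitive (c : R -> R[i]) (a b : R) : a < b -> cont_on c a b ->
  exists P, is_primitive P c a b.
Proof.
move=> ab cc.
pose cl (x : R) := Num.max a (Num.min b x).
have cl_ab x : a <= cl x /\ cl x <= b.
  by rewrite /cl le_max lexx ge_max (ltW ab) ge_min lexx.
have clid x : a <= x -> x <= b -> cl x = x.
  by move=> ax xb; rewrite /cl min_r // max_r.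
have cl1 x y : `|cl x - cl y| <= `|x - y|.
  have h1 := ler_norm (x - y); have h2 := ler_norm (y - x).
  rewrite distrC in h2; rewrite ler_norml /cl.
  by case: (leP b x) => bx; case: (leP b y) => by_; case: (leP a b) => ?;
    case: (leP a x) => ?; case: (leP a y) => ?; apply/andP; split; lra.
have contg (g : R[i] -> R) : (forall z w, `|g z - g w| <= rnorm (z - w)) ->
    continuous (fun x => g (c (cl x))).
  move=> gl x; apply/cvgrPdist_lt => e e0.
  have [ax xb] := cl_ab x; have [d d0 dP] := cc _ ax xb _ e0.
  apply/nbhs_ballP; exists d => //= y yx.
  have [ay yb] := cl_ab y.
  rewrite distrC (le_lt_trans (gl _ _)) // dP // (le_lt_trans (cl1 _ _)) //.
  by rewrite distrC.
have glRe (z w : R[i]) : `|complex.Re z - complex.Re w| <= rnorm (z - w).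
  by rewrite -raddfB; exact: Re_le_rnorm.
have glIm (z w : R[i]) : `|complex.Im z - complex.Im w| <= rnorm (z - w).
  by rewrite -raddfB; exact: Im_le_rnorm.
have [F1 F1P] := continuous_primitive (contg _ glRe) ab.
have [F2 F2P] := continuous_primitive (contg _ glIm) ab.
exists (fun x => F1 x +i* F2 x) => x ax xb e e0.
have e20 : 0 < e / 2 by rewrite divr_gt0.
have [d1 d10 d1P] := F1P x ax xb _ e20.
have [d2 d20 d2P] := F2P x ax xb _ e20.
exists (Num.min d1 d2); first by rewrite lt_min d10.
move=> y ay yb; rewrite lt_min => /andP[/d1P h1 /d2P h2].
rewrite (le_trans (rnorm_le_ReIm _)) //.
move: h1 h2; rewrite clid //; case: (c x) => u v /=.
rewrite !mul0r subr0 addr0; lra.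
Qed.

End Primitive.

(** * Goursat's theorem for rectangles *)

Section PrimTheory.
Variable R : realType.
Implicit Types (P Q c d : R -> R[i]).

Lemma is_primitive_sub P c (a b a' b' : R) : a <= a' -> b' <= b ->
  is_primitive P c a b -> is_primitive P c a' b'.
Proof.
move=> aa bb H x ax xb e e0.
have [d d0 dP] := H x (le_trans aa ax) (le_trans xb bb) e e0.
by exists d => // y ay yb; apply: dP; [exact: le_trans ay|exact: le_trans bb].
Qed.

Lemma is_primitiveB P Q c d (a b : R) : is_primitive P c a b -> is_primitive Q d a b ->
  is_primitive (fun x => P x - Q x) (fun x => c x - d x) a b.
Proof.
move=> HP HQ x ax xb e e0.
have e20 : 0 < e / 2 by rewrite divr_gt0.
have [d1 d10 d1P] := HP x ax xb _ e20.
have [d2 d20 d2P] := HQ x ax xb _ e20.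
exists (Num.min d1 d2); first by rewrite lt_min d10.
move=> y ay yb; rewrite lt_min => /andP[/(d1P y ay yb) h1 /(d2P y ay yb) h2].
have -> : P y - Q y - (P x - Q x) - (y - x)%:C * (c x - d x) =
  (P y - P x - (y - x)%:C * c x) - (Q y - Q x - (y - x)%:C * d x) by ring.
by rewrite (le_trans (rnormD _ _)) // rnormN; lra.
Qed.

Lemma is_primitiveZ P c (k : R[i]) (a b : R) : is_primitive P c a b ->
  is_primitive (fun x => k * P x) (fun x => k * c x) a b.
Proof.
move=> HP x ax xb e e0.
have k0 : 0 < rnorm k + 1 by rewrite ltr_wpDl ?rnorm_ge0.
have e20 : 0 < e / (rnorm k + 1) by rewrite divr_gt0.
have [d1 d10 d1P] := HP x ax xb _ e20.
exists d1 => // y ay yb /(d1P y ay yb) h1.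
have -> : k * P y - k * P x - (y - x)%:C * (k * c x) =
  k * (P y - P x - (y - x)%:C * c x) by ring.
rewrite rnormM; apply: (@le_trans _ _ ((rnorm k + 1) * (e / (rnorm k + 1) * `|y - x|))).
  by rewrite ler_pM ?rnorm_ge0 // lerDl.
by rewrite mulrA [_ * (e / _)]mulrC divfK ?gt_eqF.
Qed.

Lemma is_primitive_affine (p q : R[i]) (a b : R) :
  is_primitive (fun x => x%:C * p + (x ^+ 2 / 2)%:C * q) (fun x => p + x%:C * q) a b.
Proof.
move=> x ax xb e e0.
have q0 : 0 < rnorm q + 1 by rewrite ltr_wpDl ?rnorm_ge0.
exists (e / (rnorm q + 1)); first by rewrite divr_gt0.
move=> y ay yb yx.
have -> : y%:C * p + (y ^+ 2 / 2)%:C * q - (x%:C * p + (x ^+ 2 / 2)%:C * q) -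
    (y - x)%:C * (p + x%:C * q) = ((y - x) * (y - x) / 2)%:C * q.
  have -> : y%:C * p + (y ^+ 2 / 2)%:C * q - (x%:C * p + (x ^+ 2 / 2)%:C * q) -
    (y - x)%:C * (p + x%:C * q) =
    (y%:C - x%:C - (y - x)%:C) * p +
    ((y ^+ 2 / 2)%:C - (x ^+ 2 / 2)%:C - (y - x)%:C * x%:C) * q by ring.
  rewrite -!rmorphM -!rmorphB /=.
  have -> : y - x - (y - x) = 0 by ring.
  by rewrite mul0r add0r; congr (_%:C * _); field.
rewrite rnormM rnormR !normrM [`|2^-1|]ger0_norm //.
move: yx; rewrite ltr_pdivlMr // => yx.
have := rnorm_ge0 q; have := normr_ge0 (y - x).
set u := `|y - x| in yx *; set v := rnorm q in q0 yx *.
move=> u0 v0.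
have : 0 <= u * (e - u * (v + 1)) by rewrite mulr_ge0 // subr_ge0 ltW.
have : 0 <= u * u by rewrite mulr_ge0.
have : 0 <= u * u * v by rewrite !mulr_ge0.
lra.
Qed.

Lemma is_primitive_cont P c (a b : R) : is_primitive P c a b -> cont_on P a b.
Proof.
move=> HP x ax xb e e0.
have [d d0 dP] := HP x ax xb 1 ltr01.
have k0 : 0 < 1 + rnorm (c x) by rewrite ltr_wpDr ?rnorm_ge0.
exists (Num.min d (e / (1 + rnorm (c x)))); first by rewrite lt_min d0 divr_gt0.
move=> y ay yb; rewrite lt_min => /andP[/(dP y ay yb) h1].
rewrite ltr_pdivlMr // => h2.
apply: le_lt_trans h2.
have -> : P y - P x = (P y - P x - (y - x)%:C * c x) + (y - x)%:C * c x by ring.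
rewrite (le_trans (rnormD _ _)) // rnormM rnormR; lra.
Qed.

Lemma is_primitive_bound P c (a b M : R) : a <= b -> is_primitive P c a b ->
  (forall x, a <= x -> x <= b -> rnorm (c x) <= M) ->
  rnorm (P b - P a) <= M * (b - a).
Proof.
move=> ab HP HM; apply: (dini_bound (is_primitive_cont HP)) ab (lexx b).
move=> t at_ tb e e0; have [d d0 dP] := HP t at_ (ltW tb) e e0.
exists (Num.min d (b - t)); first by rewrite lt_min d0 subr_gt0.
move=> s s0; rewrite lt_min => /andP[sd sb].
have := dP (t + s); rewrite [t + s - t]addrC addKr gtr0_norm // => h.
have {}h : rnorm (P (t + s) - P t - s%:C * c t) <= e * s by apply: h => //; lra.
have -> : P (t + s) - P t = (P (t + s) - P t - s%:C * c t) + s%:C * c t by ring.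
rewrite (le_trans (rnormD _ _)) // rnormM rnormR gtr0_norm //.
have := HM t at_ (ltW tb); nra.
Qed.

(** Subtract the explicit primitive of the affine function and bound what is
    left. *)
Lemma is_primitive_near_affine P c (a b M : R) (p q : R[i]) : a <= b ->
  is_primitive P c a b ->
  (forall x, a <= x -> x <= b -> rnorm (c x - (p + x%:C * q)) <= M) ->
  rnorm (P b - P a - ((b - a)%:C * p + ((b ^+ 2 - a ^+ 2) / 2)%:C * q)) <= M * (b - a).
Proof.
move=> ab HP HM.
have := is_primitive_bound ab (is_primitiveB HP (@is_primitive_affine p q a b)) HM.
congr (rnorm _ <= _); rewrite mulrBl !rmorphB /=; ring.
Qed.

End PrimTheory.


Section Bisection.
Variable R : realType.

Lemma nested_point (a b : nat -> R) :
  (forall k, a k <= a k.+1) -> (forall k, b k.+1 <= b k) ->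
  (forall k, a k <= b k) -> exists p, forall k, a k <= p /\ p <= b k.
Proof.
move=> ha hb hab.
have ham k l : (k <= l)%N -> a k <= a l.
  by move=> kl; exact: (homo_leq (@lexx _ R) (@le_trans _ R) ha).
have hbm k l : (k <= l)%N -> b l <= b k.
  by move=> kl; apply: (homo_leq (@lexx _ R^d) (@le_trans _ R^d) hb).
have hlk k l : a k <= b l.
  have [kl|lk] := leqP k l; first exact: le_trans (ham _ _ kl) (hab l).
  exact: le_trans (hab k) (hbm _ _ (ltnW lk)).
exists (sup (range a)) => k; split.
  apply: ub_le_sup; last by exists k.
  by exists (b 0) => _ [l _ <-].
apply: ge_sup; first by exists (a 0); exists 0.
by move=> _ [l _ <-].
Qed.

(** If the property failed for the whole rectangle, it would fail for one of its
    quarters, and so on; the nested quarters shrink to a point at which the local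
    hypothesis is contradicted. *)
Lemma rect_bisection (P : R -> R -> R -> R -> Prop) (X1 X2 Y1 Y2 : R) :
  X1 < X2 -> Y1 < Y2 ->
  (forall a b c d, X1 <= a -> a < b -> b <= X2 -> Y1 <= c -> c < d -> d <= Y2 ->
    P a ((a + b) / 2) c ((c + d) / 2) -> P ((a + b) / 2) b c ((c + d) / 2) ->
    P a ((a + b) / 2) ((c + d) / 2) d -> P ((a + b) / 2) b ((c + d) / 2) d ->
    P a b c d) ->
  (forall x y, X1 <= x -> x <= X2 -> Y1 <= y -> y <= Y2 ->
    exists2 e : R, 0 < e & forall a b c d, X1 <= a -> a < b -> b <= X2 ->
      Y1 <= c -> c < d -> d <= Y2 -> a <= x -> x <= b -> c <= y -> y <= d ->
      b - a < e -> d - c < e -> P a b c d) ->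
  P X1 X2 Y1 Y2.
Proof.
move=> X12 Y12 Pglue Ploc; apply: contrapT => nP.
pose bad (q : R * R * (R * R)) :=
  [/\ X1 <= q.1.1, q.1.1 < q.1.2, q.1.2 <= X2 & [/\
   Y1 <= q.2.1, q.2.1 < q.2.2, q.2.2 <= Y2 & ~ P q.1.1 q.1.2 q.2.1 q.2.2]].
pose quarter (q q' : R * R * (R * R)) :=
  [/\ q.1.1 <= q'.1.1, q'.1.2 <= q.1.2, q'.1.2 - q'.1.1 = (q.1.2 - q.1.1) / 2 & [/\
   q.2.1 <= q'.2.1, q'.2.2 <= q.2.2 & q'.2.2 - q'.2.1 = (q.2.2 - q.2.1) / 2]].
have step q : exists q', bad q -> bad q' /\ quarter q q'.
  have [[[h1 h2 h3 [h4 h5 h6 nPq]]]|nb] := pselect (bad q); last by exists q.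
  have {nPq} : exists q', (q'.1.1 = q.1.1 /\ q'.1.2 = (q.1.1 + q.1.2) / 2 \/
     q'.1.1 = (q.1.1 + q.1.2) / 2 /\ q'.1.2 = q.1.2) /\
     (q'.2.1 = q.2.1 /\ q'.2.2 = (q.2.1 + q.2.2) / 2 \/
     q'.2.1 = (q.2.1 + q.2.2) / 2 /\ q'.2.2 = q.2.2) /\
     ~ P q'.1.1 q'.1.2 q'.2.1 q'.2.2.
    apply: contrapT => /forallNP nq; apply: nPq; apply: Pglue => //; apply: contrapT.
    - by move=> np; apply: (nq (q.1.1, (q.1.1 + q.1.2) / 2, (q.2.1, (q.2.1 + q.2.2) / 2)));
        split; [left|split; [left|]].
    - by move=> np; apply: (nq ((q.1.1 + q.1.2) / 2, q.1.2, (q.2.1, (q.2.1 + q.2.2) / 2)));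
        split; [right|split; [left|]].
    - by move=> np; apply: (nq (q.1.1, (q.1.1 + q.1.2) / 2, ((q.2.1 + q.2.2) / 2, q.2.2)));
        split; [left|split; [right|]].
    - by move=> np; apply: (nq ((q.1.1 + q.1.2) / 2, q.1.2, ((q.2.1 + q.2.2) / 2, q.2.2)));
        split; [right|split; [right|]].
  move=> [q' [hx [hy np]]]; exists q' => _.
  case: hx hy => -[e1 e2] [] [e3 e4]; split; split; try split => //;
    rewrite ?e1 ?e2 ?e3 ?e4; try exact: np; clear -h1 h2 h3 h4 h5 h6; lra.
pose next q := sval (cid (step q)).
have nextP q : bad q -> bad (next q) /\ quarter q (next q) by exact: svalP (cid (step q)).
pose s k := iter k next (X1, X2, (Y1, Y2)).
have bads k : bad (s k).
  elim: k => [|k IH]; last by have [] := nextP _ IH.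
  by split => //=; split.
have quart k : quarter (s k) (s k.+1) by have [] := nextP _ (bads k).
have wx k : (s k).1.2 - (s k).1.1 = (X2 - X1) / 2 ^+ k.
  elim: k => [|k IH]; first by rewrite expr0 divr1.
  by have [_ _ -> _] := quart k; rewrite IH exprS invfM mulrA mulrAC.
have wy k : (s k).2.2 - (s k).2.1 = (Y2 - Y1) / 2 ^+ k.
  elim: k => [|k IH]; first by rewrite expr0 divr1.
  by have [_ _ _ [_ _ ->]] := quart k; rewrite IH exprS invfM mulrA mulrAC.
have [x xP] : exists x, forall k, (s k).1.1 <= x /\ x <= (s k).1.2.
  apply: nested_point => k; [by have [] := quart k|by have [] := quart k|].
  by have [_ /ltW] := bads k.
have [y yP] : exists y, forall k, (s k).2.1 <= y /\ y <= (s k).2.2.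
  apply: nested_point => k; [by have [_ _ _ []] := quart k|by have [_ _ _ []] := quart k|].
  by have [_ _ _ [_ /ltW]] := bads k.
have [x1 x2] := xP 0; have [y1 y2] := yP 0.
have [e e0 eP] := Ploc x y x1 x2 y1 y2.
pose k := maxn (Num.bound ((X2 - X1) / e)) (Num.bound ((Y2 - Y1) / e)).
have small w : (Num.bound (w / e) <= k)%N -> w / 2 ^+ k < e.
  move=> /upper_nthrootP; rewrite ltr_pdivrMr // => h.
  by rewrite ltr_pdivrMr ?exprn_gt0 // mulrC.
have [h1 h2 h3 [h4 h5 h6 np]] := bads k; apply: np.
have [xk1 xk2] := xP k; have [yk1 yk2] := yP k.
apply: eP => //; rewrite ?wx ?wy; apply: small; first exact: leq_maxl.
exact: leq_maxr.
Qed.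
End Bisection.

Section Goursat.
Variable R : realType.
Implicit Types (f : R[i] -> R[i]) (PH PV : R -> R -> R[i]).

(** [d] is the complex derivative of [f] at [z]. *)
Definition has_cderiv f (z : R[i]) (d : R[i]) := forall e : R, 0 < e ->
  exists2 r : R, 0 < r & forall w, rnorm (w - z) < r ->
    rnorm (f w - f z - d * (w - z)) <= e * rnorm (w - z).

(** The integral over the boundary of [[x1, x2] x [y1, y2]], counterclockwise,
    of a function with primitives [PH y] along the horizontal line at height [y]
    and [PV x] along the vertical line at abscissa [x].  Expressed through
    primitives rather than integrals, additivity under subdivision becomes a ring
    identity. *)
Definition contour PH PV (x1 x2 y1 y2 : R) : R[i] :=
  (PH y1 x2 - PH y1 x1) + (0 +i* 1) * (PV x2 y2 - PV x2 y1)
  - (PH y2 x2 - PH y2 x1) - (0 +i* 1) * (PV x1 y2 - PV x1 y1).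

Lemma contour_quarters PH PV (a b c d m n : R) :
  contour PH PV a b c d = contour PH PV a m c n + contour PH PV m b c n +
    contour PH PV a m n d + contour PH PV m b n d.
Proof. rewrite /contour; ring. Qed.

(** Near each point [f] is affine up to an error small compared with the diameter
    [l]; the affine part contributes nothing and the rest at most [e * l ^+ 2].
    This bound survives gluing four quarters, as [4 * (l / 2) ^+ 2 = l ^+ 2], so
    it holds for the whole rectangle, whatever [e]. *)
Lemma goursat f PH PV (X1 X2 Y1 Y2 : R) : X1 < X2 -> Y1 < Y2 ->
  (forall y, Y1 <= y -> y <= Y2 -> is_primitive (PH y) (fun x => f (x +i* y)) X1 X2) ->
  (forall x, X1 <= x -> x <= X2 -> is_primitive (PV x) (fun y => f (x +i* y)) Y1 Y2) ->
  (forall x y, X1 <= x -> x <= X2 -> Y1 <= y -> y <= Y2 ->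
    exists d, has_cderiv f (x +i* y) d) ->
  contour PH PV X1 X2 Y1 Y2 = 0.
Proof.
move=> X12 Y12 HH HV Hd; apply: rnorm_eq0.
apply/ler_addgt0Pr => e' e'0; rewrite add0r.
pose L := (X2 - X1) + (Y2 - Y1).
have L0 : 0 < L by rewrite /L; lra.
pose e := e' / L ^+ 2.
have e0 : 0 < e by rewrite divr_gt0 // exprn_gt0.
have -> : e' = e * L ^+ 2 by rewrite /e divfK // expf_neq0 // gt_eqF.
rewrite /L; apply: (@rect_bisection R
  (fun a b c d => rnorm (contour PH PV a b c d) <= e * ((b - a) + (d - c)) ^+ 2) _ _ _ _ X12 Y12).
  move=> a b c d _ _ _ _ _ _ h1 h2 h3 h4.
  rewrite (contour_quarters _ _ _ _ _ _ ((a + b) / 2) ((c + d) / 2)).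
  apply: le_trans (rnormD _ _) _; apply: le_trans (lerD (rnormD _ _) (lexx _)) _.
  apply: le_trans (lerD (lerD (rnormD _ _) (lexx _)) (lexx _)) _.
  apply: le_trans (lerD (lerD (lerD h1 h2) h3) h4) _.
  rewrite le_eqVlt; apply/orP; left; apply/eqP; by field.
move=> x y x1 x2 y1 y2.
have [D HD] := Hd x y x1 x2 y1 y2.
have e20 : 0 < e / 2 by rewrite divr_gt0.
have [r r0 rP] := HD _ e20.
exists (r / 2); first by rewrite divr_gt0.
move=> a b c d Xa ab bX Yc cd dY ax xb cy yd bar dcr.
set l := (b - a) + (d - c).
have lr : l < r by rewrite /l; lra.
have near u v : a <= u -> u <= b -> c <= v -> v <= d ->
    rnorm (f (u +i* v) - f (x +i* y) - D * ((u +i* v) - (x +i* y))) <= e / 2 * l.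
  move=> au ub cv vd.
  have uvl : rnorm ((u +i* v) - (x +i* y)) <= l.
    rewrite (le_trans (rnorm_le_ReIm _)) //= lerD // ler_norml; apply/andP; split; lra.
  rewrite (le_trans (rP _ (le_lt_trans uvl lr))) // ler_wpM2l //; exact: ltW.
pose p := f (x +i* y) - D * (x +i* y).
have H1 v : c <= v -> v <= d ->
    rnorm (PH v b - PH v a - ((b - a)%:C * (p + D * (0 +i* v)) +
      ((b ^+ 2 - a ^+ 2) / 2)%:C * D)) <= e / 2 * l * (b - a).
  move=> cv vd; apply: (@is_primitive_near_affine R (PH v) (fun x => f (x +i* v)));
    first exact: ltW.
    apply: is_primitive_sub (HH v _ _) => //; [exact: le_trans cv|exact: le_trans dY].
  move=> u au ub; apply: le_trans (near u v au ub cv vd).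
  rewrite /p (_ : u +i* v = u%:C + (0 +i* v)); last by rewrite /real_complex_def; simpc.
  by rewrite le_eqVlt; apply/orP; left; apply/eqP; congr rnorm; ring.
have H2 u : a <= u -> u <= b ->
    rnorm (PV u d - PV u c - ((d - c)%:C * (p + D * u%:C) +
      ((d ^+ 2 - c ^+ 2) / 2)%:C * (D * (0 +i* 1)))) <= e / 2 * l * (d - c).
  move=> au ub; apply: (@is_primitive_near_affine R (PV u) (fun y => f (u +i* y)));
    first exact: ltW.
    apply: is_primitive_sub (HV u _ _) => //; [exact: le_trans au|exact: le_trans bX].
  move=> v cv vd; apply: le_trans (near u v au ub cv vd).
  rewrite /p (_ : u +i* v = u%:C + v%:C * (0 +i* 1)); last by rewrite /real_complex_def; simpc.
  by rewrite le_eqVlt; apply/orP; left; apply/eqP; congr rnorm; ring.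
have h1 := H1 c (lexx c) (ltW cd); have h2 := H1 d (ltW cd) (lexx d).
have h3 := H2 a (lexx a) (ltW ab); have h4 := H2 b (ltW ab) (lexx b).
set A1 := (X in rnorm X <= _) in h1; set A2 := (X in rnorm X <= _) in h2.
set A3 := (X in rnorm X <= _) in h3; set A4 := (X in rnorm X <= _) in h4.
have -> : contour PH PV a b c d = A1 - A2 - (0 +i* 1) * A3 + (0 +i* 1) * A4.
  rewrite /contour /A1 /A2 /A3 /A4.
  have -> : 0 +i* c = c%:C * (0 +i* 1) by rewrite /real_complex_def; simpc.
  have -> : 0 +i* d = d%:C * (0 +i* 1) by rewrite /real_complex_def; simpc.
  rewrite !rmorphB /=; ring.
have ii := rnorm_i R.
have : rnorm (A1 - A2 - (0 +i* 1) * A3 + (0 +i* 1) * A4) <=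
    rnorm A1 + rnorm A2 + rnorm A3 + rnorm A4.
  rewrite (le_trans (rnormD _ _)) // rnormM ii mul1r lerD //.
  rewrite (le_trans (rnormD _ _)) // rnormN rnormM ii mul1r lerD //.
  by rewrite (le_trans (rnormD _ _)) // rnormN.
have : e / 2 * l * (b - a) * 2 + e / 2 * l * (d - c) * 2 = e * l ^+ 2.
  by rewrite /l; field.
lra.
Qed.
End Goursat.

(** * Complex derivatives and continuity along segments *)

Section Cdiff.
Variable R : realType.
Implicit Types (f g : R[i] -> R[i]).

Lemma has_cderiv_cont f z d : has_cderiv f z d -> forall e : R, 0 < e ->
  exists2 r : R, 0 < r & forall w, rnorm (w - z) < r -> rnorm (f w - f z) < e.
Proof.
move=> Hf e e0; have [r r0 rP] := Hf 1 ltr01.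
have k0 : 0 < 1 + rnorm d by rewrite ltr_pwDl ?rnorm_ge0.
exists (Num.min r (e / (1 + rnorm d))); first by rewrite lt_min r0 divr_gt0.
move=> w; rewrite lt_min => /andP[/rP h1]; rewrite ltr_pdivlMr // => h2.
have -> : f w - f z = (f w - f z - d * (w - z)) + d * (w - z) by ring.
rewrite (le_lt_trans (rnormD _ _)) // rnormM; lra.
Qed.

Lemma has_cderivM f g z d e : has_cderiv f z d -> has_cderiv g z e ->
  has_cderiv (fun w => f w * g w) z (d * g z + f z * e).
Proof.
move=> Hf Hg k k0.
pose M := rnorm (g z) + 1 + rnorm (f z) + rnorm d.
have gz0 := rnorm_ge0 (g z); have fz0 := rnorm_ge0 (f z); have d0 := rnorm_ge0 d.
have M0 : 0 < M by rewrite /M; lra.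
pose k1 := Num.min 1 (k / M).
have k10 : 0 < k1 by rewrite lt_min ltr01 divr_gt0.
have k11 : k1 <= 1 by rewrite /k1 ge_min lexx.
have k1M : k1 * M <= k by rewrite -ler_pdivlMr // /k1 ge_min lexx orbT.
have [r1 r10 r1P] := Hf _ k10; have [r2 r20 r2P] := Hg _ k10.
have [r3 r30 r3P] := has_cderiv_cont Hg k10.
exists (Num.min r1 (Num.min r2 r3)); first by rewrite !lt_min r10 r20.
move=> w; rewrite !lt_min => /and3P[/r1P h1 /r2P h2 /r3P h3].
have -> : f w * g w - f z * g z - (d * g z + f z * e) * (w - z) =
  (f w - f z - d * (w - z)) * g w + f z * (g w - g z - e * (w - z)) +
  d * (w - z) * (g w - g z) by ring.
have gw : rnorm (g w) <= rnorm (g z) + 1.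
  have -> : g w = g z + (g w - g z) by ring.
  rewrite (le_trans (rnormD _ _)) // lerD2l; lra.
have n0 := rnorm_ge0 (w - z).
apply: (@le_trans _ _ (k1 * M * rnorm (w - z))); last by rewrite ler_wpM2r.
rewrite (le_trans (rnormD _ _)) //.
rewrite (le_trans (lerD (rnormD _ _) (lexx _))) // !rnormM.
have e1 : rnorm (f w - f z - d * (w - z)) * rnorm (g w) <=
  k1 * rnorm (w - z) * (rnorm (g z) + 1) by apply: ler_pM; rewrite ?rnorm_ge0.
have e2 : rnorm (f z) * rnorm (g w - g z - e * (w - z)) <=
  rnorm (f z) * (k1 * rnorm (w - z)) by rewrite ler_wpM2l.
have e3 : rnorm d * rnorm (w - z) * rnorm (g w - g z) <=
  rnorm d * rnorm (w - z) * k1 by rewrite ler_wpM2l ?mulr_ge0 // ltW.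
have -> : k1 * M * rnorm (w - z) = k1 * rnorm (w - z) * (rnorm (g z) + 1) +
  rnorm (f z) * (k1 * rnorm (w - z)) + rnorm d * rnorm (w - z) * k1.
  by rewrite /M; ring.
lra.
Qed.

Lemma has_cderiv_near f g z d (r : R) : 0 < r ->
  (forall w, rnorm (w - z) < r -> f w = g w) -> has_cderiv f z d -> has_cderiv g z d.
Proof.
move=> r0 fg Hf e e0; have [r1 r10 r1P] := Hf e e0.
exists (Num.min r r1); first by rewrite lt_min r0.
move=> w; rewrite lt_min => /andP[wr /r1P].
by rewrite !fg // subrr rnorm0.
Qed.

Lemma has_cderiv_subaffine f z d a b : has_cderiv f z d ->
  has_cderiv (fun w => f w - a - b * w) z (d - b).
Proof.
move=> Hf e e0; have [r r0 rP] := Hf e e0; exists r => // w /rP.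
by congr (rnorm _ <= _); ring.
Qed.

Lemma has_cderivV (z : R[i]) : z != 0 -> has_cderiv (fun w => w^-1) z (- z^-1 ^+ 2).
Proof.
move=> z0 e e0.
have nz0 := rnorm_gt0 z0.
exists (Num.min (rnorm z / 2) (e * rnorm z ^+ 3 / 2)).
  by rewrite lt_min !divr_gt0 // mulr_gt0 // exprn_gt0.
move=> w; rewrite lt_min => /andP[h1 h2].
have nw : rnorm z / 2 <= rnorm w.
  have := rnorm_triangle w z 0; rewrite !subr0 rnormB; lra.
have w0 : w != 0.
  by apply/eqP => w0; move: nw; rewrite w0 rnorm0; lra.
have -> : w^-1 - z^-1 - - z^-1 ^+ 2 * (w - z) = (w - z) * (w - z) / (w * z ^+ 2).
  by field; rewrite w0 z0.
have nw0 : 0 < rnorm w by rewrite rnorm_gt0.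
have den : rnorm (w * z ^+ 2) = rnorm w * rnorm z ^+ 2 by rewrite !expr2 !rnormM.
have den0 : 0 < rnorm (w * z ^+ 2) by rewrite den mulr_gt0 // exprn_gt0.
have inv : rnorm ((w * z ^+ 2)^-1) = (rnorm (w * z ^+ 2))^-1.
  by rewrite rnormV // mulf_neq0 // expf_neq0.
rewrite rnormM inv rnormM ler_pdivrMr // [leRHS]mulrAC ler_wpM2r ?rnorm_ge0 //.
apply: le_trans (ltW h2) _; rewrite den.
have -> : e * rnorm z ^+ 3 / 2 = e * ((rnorm z / 2) * rnorm z ^+ 2) by field.
by apply: (ler_wpM2l (ltW e0)); apply: ler_wpM2r nw; rewrite exprn_ge0 // ltW.
Qed.

End Cdiff.

Section ContOn.
Variable R : realType.
Implicit Types (c d : R -> R[i]).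

Lemma cont_onM c d (a b : R) : cont_on c a b -> cont_on d a b ->
  cont_on (fun x => c x * d x) a b.
Proof.
move=> Hc Hd x ax xb e e0.
pose M := rnorm (d x) + 1 + rnorm (c x).
have d0 := rnorm_ge0 (d x); have c0 := rnorm_ge0 (c x).
have M0 : 0 < M by rewrite /M; lra.
pose k := Num.min 1 (e / 2 / M).
have k0 : 0 < k by rewrite lt_min ltr01 !divr_gt0.
have k1 : k <= 1 by rewrite /k ge_min lexx.
have kM : k * M <= e / 2 by rewrite -ler_pdivlMr // /k ge_min lexx orbT.
have [r1 r10 r1P] := Hc x ax xb _ k0; have [r2 r20 r2P] := Hd x ax xb _ k0.
exists (Num.min r1 r2); first by rewrite lt_min r10.
move=> y ay yb; rewrite lt_min => /andP[/(r1P y ay yb) h1 /(r2P y ay yb) h2].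
have -> : c y * d y - c x * d x = (c y - c x) * d y + c x * (d y - d x) by ring.
have dy : rnorm (d y) <= rnorm (d x) + 1.
  have -> : d y = d x + (d y - d x) by ring.
  rewrite (le_trans (rnormD _ _)) // lerD2l; lra.
rewrite (le_lt_trans (rnormD _ _)) // !rnormM.
have e1 : rnorm (c y - c x) * rnorm (d y) <= k * (rnorm (d x) + 1).
  by apply: ler_pM; rewrite ?rnorm_ge0 // ltW.
have e2 : rnorm (c x) * rnorm (d y - d x) <= rnorm (c x) * k by rewrite ler_wpM2l // ltW.
have : k * M = k * (rnorm (d x) + 1) + rnorm (c x) * k by rewrite /M; ring.
lra.
Qed.

Lemma cont_on_ReIm (g h : R -> R) (a b : R) : continuous g -> continuous h ->
  cont_on (fun x => g x +i* h x) a b.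
Proof.
move=> Hg Hh x _ _ e e0.
have e20 : 0 < e / 2 by rewrite divr_gt0.
have /cvgrPdist_lt /(_ _ e20) /nbhs_ballP[r1 /= r10 r1P] := Hg x.
have /cvgrPdist_lt /(_ _ e20) /nbhs_ballP[r2 /= r20 r2P] := Hh x.
exists (Num.min r1 r2); first by rewrite lt_min r10.
move=> y _ _; rewrite lt_min => /andP[h1 h2].
have {}h1 : `|g x - g y| < e / 2 by apply: r1P; rewrite /ball /= distrC.
have {}h2 : `|h x - h y| < e / 2 by apply: r2P; rewrite /ball /= distrC.
rewrite (le_lt_trans (rnorm_le_ReIm _)) //=.
rewrite [`|g y - _|]distrC [`|h y - _|]distrC; lra.
Qed.

Lemma cont_on_comp (f : R[i] -> R[i]) c (a b : R) :
  (forall x, a <= x -> x <= b -> exists D, has_cderiv f (c x) D) ->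
  (forall x y, rnorm (c y - c x) <= `|y - x|) ->
  cont_on (fun x => f (c x)) a b.
Proof.
move=> Hf Hc x ax xb e e0.
have [d Hd] := Hf x ax xb.
have [r r0 rP] := has_cderiv_cont Hd e0.
by exists r => // y ay yb yx; apply: rP; exact: le_lt_trans yx.
Qed.
End ContOn.

(** * Cauchy's estimate *)

Section Cauchy.
Variable R : realType.

Definition sqmod (z : R[i]) : R := complex.Re z ^+ 2 + complex.Im z ^+ 2.

(** [z^-1] for [rho <= |z|], written as the conjugate over the squared modulus,
    and continued continuously through 0 by freezing the denominator.  This keeps
    the Cauchy kernel continuous on the whole square, so that it has primitives
    along all horizontal and vertical lines, including those through 0. *)
Definition trunc_inv (rho : R) (z : R[i]) : R[i] :=
  let s := Num.max (sqmod z) (rho ^+ 2) in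
  (complex.Re z / s) +i* (- complex.Im z / s).

Lemma sqmod_rnorm z : sqmod z = rnorm z ^+ 2.
Proof.
rewrite /sqmod /rnorm normc_def /=; case: z => x y /=.
by rewrite sqr_sqrtr // addr_ge0 // sqr_ge0.
Qed.

Lemma trunc_invE (rho : R) z : 0 < rho -> rho <= rnorm z -> z * trunc_inv rho z = 1.
Proof.
move=> rho0 hz; rewrite /trunc_inv max_l; last first.
  by rewrite sqmod_rnorm ler_sqr ?nnegrE ?rnorm_ge0 // ltW.
have : sqmod z != 0.
  by rewrite sqmod_rnorm expf_neq0 // gt_eqF // (lt_le_trans rho0).
rewrite /sqmod; case: z {hz} => x y /= n0.
by apply/eqP; rewrite eq_complex /=; apply/andP; split; apply/eqP; field.
Qed.

Lemma continuous_trunc_inv_s (rho y : R) : 0 < rho ->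
  continuous (fun x : R => (Num.max (x ^+ 2 + y ^+ 2) (rho ^+ 2))^-1).
Proof.
move=> rho0 x; apply: cvgV.
  by rewrite gt_eqF // lt_max exprn_gt0 ?orbT.
apply: (@continuous_max _ _ (fun x : R => x ^+ 2 + y ^+ 2) (fun=> rho ^+ 2)).
  by apply: cvgD; [exact: exprn_continuous|exact: cvg_cst].
exact: cvg_cst.
Qed.

Lemma cont_on_trunc_inv_h (rho y a b : R) : 0 < rho ->
  cont_on (fun x => trunc_inv rho (x +i* y)) a b.
Proof.
move=> rho0; apply: cont_on_ReIm => x /=; rewrite /sqmod /=.
  by apply: cvgM; [exact: cvg_id|exact: continuous_trunc_inv_s].
by apply: cvgM; [exact: cvg_cst|exact: continuous_trunc_inv_s].
Qed.

Lemma cont_on_trunc_inv_v (rho x a b : R) : 0 < rho ->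
  cont_on (fun y => trunc_inv rho (x +i* y)) a b.
Proof.
move=> rho0; rewrite /trunc_inv /sqmod /=.
apply: cont_on_ReIm => y /=; under eq_fun do rewrite addrC.
  by apply: cvgM; [exact: cvg_cst|exact: continuous_trunc_inv_s].
by apply: cvgM; [apply: cvgN; exact: cvg_id|exact: continuous_trunc_inv_s].
Qed.

Lemma rnorm_trunc_inv (rho k : R) z : 0 < rho -> rho <= rnorm z -> 0 < k -> k <= rnorm z ->
  rnorm (trunc_inv rho z) <= k^-1.
Proof.
move=> rho0 rz k0 kz; have := congr1 (@rnorm R _) (trunc_invE rho0 rz).
rewrite rnormM rnormR normr1 => zw.
have nz : 0 < rnorm z by exact: lt_le_trans kz.
rewrite -(ler_pM2l nz) zw -ler_pdivrMr ?invr_gt0 // invrK mul1r //.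
Qed.

Lemma has_cderiv_trunc_inv (rho : R) z : 0 < rho -> rho < rnorm z ->
  has_cderiv (trunc_inv rho) z (- z^-1 ^+ 2).
Proof.
move=> rho0 rz; have z0 : z != 0.
  by apply/eqP => z0; move: rz; rewrite z0 rnorm0; lra.
have d0 : 0 < rnorm z - rho by rewrite subr_gt0.
apply: (has_cderiv_near d0 _ (has_cderivV z0)) => w wz.
have rw : rho <= rnorm w.
  have := rnorm_triangle w z 0; rewrite !subr0 rnormB; lra.
have w0 : w != 0.
  by apply/eqP => w0; move: rw; rewrite w0 rnorm0; lra.
by apply: (mulfI w0); rewrite trunc_invE // divff.
Qed.

Lemma is_primitive_Im P c (a b p M : R) : a <= b -> is_primitive P c a b ->
  (forall x, a <= x -> x <= b -> `|complex.Im (c x) - p| <= M) ->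
  complex.Im (P b - P a) <= (M + p) * (b - a).
Proof.
move=> ab HP HM.
pose P' x := (complex.Im (P x))%:C; pose c' x := (complex.Im (c x))%:C.
have HP' : is_primitive P' c' a b.
  move=> x ax xb e e0; have [d d0 dP] := HP x ax xb e e0.
  exists d => // y ay yb /(dP y ay yb); apply: le_trans.
  apply: le_trans (Im_le_rnorm _).
  rewrite /P' /c' -!rmorphM -!rmorphB rnormR.
  rewrite !raddfB /= le_eqVlt; apply/orP; left; apply/eqP; congr `| _ - _ |.
  by case: (c x) => u v /=; rewrite subrr mul0r addr0.
have := @is_primitive_near_affine R P' c' a b M p%:C 0 ab HP'.
have H' x : a <= x -> x <= b -> rnorm (c' x - (p%:C + x%:C * 0)) <= M.
  by move=> ax xb; rewrite mulr0 addr0 /c' -rmorphB rnormR HM.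
move=> /(_ H'); rewrite mulr0 addr0 /P' -!rmorphM -!rmorphB /= rnormR.
move=> /(le_trans (ler_norm _)); rewrite raddfB /=; lra.
Qed.


Definition grid_primitives (f : R[i] -> R[i]) (PH PV : R -> R -> R[i]) (r : R) :=
  (forall y, `|y| <= r -> is_primitive (PH y) (fun x => f (x +i* y)) (- r) r) /\
  (forall x, `|x| <= r -> is_primitive (PV x) (fun y => f (x +i* y)) (- r) r).

(** [(F z - F 0 - d * z) / z ^+ 2] away from 0. *)
Definition cauchy_kernel (F : R[i] -> R[i]) (d : R[i]) (rho : R) (z : R[i]) : R[i] :=
  (F z - F 0 - d * z) * trunc_inv rho z * trunc_inv rho z.

Lemma norm_le_box (r a b x : R) : - r <= a -> b <= r -> a <= x -> x <= b -> `|x| <= r.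
Proof. by move=> ra br ax xb; rewrite ler_norml (le_trans ra ax) (le_trans xb br). Qed.

Lemma cauchy_kernel_grid_primitives F d (r rho : R) : 0 < r -> 0 < rho ->
  (forall x y, `|x| <= r -> `|y| <= r -> exists D, has_cderiv F (x +i* y) D) ->
  exists PH PV, grid_primitives (cauchy_kernel F d rho) PH PV r.
Proof.
move=> r0 rho0 HF.
have HF' x y : `|x| <= r -> `|y| <= r ->
    exists D, has_cderiv (fun z => F z - F 0 - d * z) (x +i* y) D.
  by move=> hx hy; have [D HD] := HF x y hx hy; exists (D - d); exact: has_cderiv_subaffine.
have Nrr : - r < r by lra.
have primH y : exists P, `|y| <= r ->
    is_primitive P (fun x => cauchy_kernel F d rho (x +i* y)) (- r) r.
  have [hy|] := pselect (`|y| <= r); last by exists (fun=> 0).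
  have [|P HP] := cont_on_primitive (c := fun x => cauchy_kernel F d rho (x +i* y)) Nrr;
    last by exists P.
  apply: cont_onM; [apply: cont_onM|]; try exact: cont_on_trunc_inv_h.
  apply: (@cont_on_comp R (fun z => F z - F 0 - d * z) (fun x => x +i* y)).
    by move=> x h1 h2; apply: HF' => //; exact: (norm_le_box (lexx _) (lexx r)).
  by move=> x x'; rewrite (le_trans (rnorm_le_ReIm _)) //= subrr normr0 addr0.
have primV x : exists P, `|x| <= r ->
    is_primitive P (fun y => cauchy_kernel F d rho (x +i* y)) (- r) r.
  have [hx|] := pselect (`|x| <= r); last by exists (fun=> 0).
  have [|P HP] := cont_on_primitive (c := fun y => cauchy_kernel F d rho (x +i* y)) Nrr;
    last by exists P.
  apply: cont_onM; [apply: cont_onM|]; try exact: cont_on_trunc_inv_v.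
  apply: (@cont_on_comp R (fun z => F z - F 0 - d * z) (fun y => x +i* y)).
    by move=> y h1 h2; apply: HF' => //; exact: (norm_le_box (lexx _) (lexx r)).
  by move=> y y'; rewrite (le_trans (rnorm_le_ReIm _)) //= subrr normr0 add0r.
have [PH HPH] := choice primH; have [PV HPV] := choice primV.
by exists PH, PV.
Qed.

(** The region between the two squares is the union of four rectangles, on each
    of which Goursat's theorem applies. *)
Lemma contour_annulus f PH PV (q r : R) : 0 < q -> q < r -> grid_primitives f PH PV r ->
  (forall x y, `|x| <= r -> `|y| <= r -> q <= `|x| \/ q <= `|y| ->
    exists D, has_cderiv f (x +i* y) D) ->
  contour PH PV (- r) r (- r) r = contour PH PV (- q) q (- q) q.
Proof.
move=> q0 qr [HPH HPV] Hf.
have rect0 a b c e : - r <= a -> a < b -> b <= r -> - r <= c -> c < e -> e <= r ->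
    (forall x y, a <= x -> x <= b -> c <= y -> y <= e -> q <= `|x| \/ q <= `|y|) ->
    contour PH PV a b c e = 0.
  move=> ra ab br rc ce er far.
  apply: (@goursat R f) => //.
  - move=> y cy ye; apply: is_primitive_sub (HPH y _) => //; exact: norm_le_box cy ye.
  - move=> x ax xb; apply: is_primitive_sub (HPV x _) => //; exact: norm_le_box ax xb.
  move=> x y ax xb cy ye.
  by apply: Hf; [exact: norm_le_box ax xb|exact: norm_le_box cy ye|exact: far].
have right_of (x : R) : q <= x -> q <= `|x| by move/le_trans; apply; exact: ler_norm.
have left_of (x : R) : x <= - q -> q <= `|x|.
  by rewrite lerNr -normrN => /le_trans; apply; exact: ler_norm.
have [rq Nqq Nrq] : [/\ - r < - q, - q < q & - r < r] by split; lra.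
have e1 : contour PH PV (- r) (- q) (- r) r = 0.
  by apply: rect0 => //; [lra|move=> x y _ xq _ _; left; exact: left_of].
have e2 : contour PH PV q r (- r) r = 0.
  by apply: rect0 => //; [lra|move=> x y xq _ _ _; left; exact: right_of].
have e3 : contour PH PV (- q) q (- r) (- q) = 0.
  by apply: rect0 => //; try lra; move=> x y _ _ _ yq; right; exact: left_of.
have e4 : contour PH PV (- q) q q r = 0.
  by apply: rect0 => //; try lra; move=> x y _ _ yq _; right; exact: right_of.
rewrite (_ : contour PH PV (- r) r (- r) r = contour PH PV (- r) (- q) (- r) r +
  contour PH PV q r (- r) r + contour PH PV (- q) q (- r) (- q) + contour PH PV (- q) q q r +
  contour PH PV (- q) q (- q) q); last by rewrite /contour; ring.
by rewrite e1 e2 e3 e4 !add0r.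
Qed.

Lemma contour_bound f PH PV (q r M : R) : 0 < q -> q <= r -> grid_primitives f PH PV r ->
  (forall x y, `|x| <= q -> `|y| <= q -> q <= `|x| \/ q <= `|y| ->
    rnorm (f (x +i* y)) <= M) ->
  rnorm (contour PH PV (- q) q (- q) q) <= 8 * q * M.
Proof.
move=> q0 qr [HPH HPV] HM.
have Nqq : - q <= q by lra.
have rq : - r <= - q by rewrite lerN2.
have nq : `|q| = q by rewrite gtr0_norm.
have nqN : `|- q| = q by rewrite normrN.
have sideH y : `|y| = q -> rnorm (PH y q - PH y (- q)) <= M * (q - - q).
  move=> yq; apply: (@is_primitive_bound R (PH y) (fun x => f (x +i* y))) => //.
    by apply: is_primitive_sub (HPH y _) => //; rewrite yq.
  by move=> x h1 h2; apply: HM; rewrite ?yq ?ler_norml ?h1 //; right.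
have sideV x : `|x| = q -> rnorm (PV x q - PV x (- q)) <= M * (q - - q).
  move=> xq; apply: (@is_primitive_bound R (PV x) (fun y => f (x +i* y))) => //.
    by apply: is_primitive_sub (HPV x _) => //; rewrite xq.
  by move=> y h1 h2; apply: HM; rewrite ?xq ?ler_norml ?h1 //; left.
have := sideH _ nq; have := sideH _ nqN; have := sideV _ nq; have := sideV _ nqN.
rewrite /contour.
set A := PV (- q) q - _; set B := PV q q - _.
set C := PH (- q) q - _; set D := PH q q - _.
have : rnorm (C + (0 +i* 1) * B - D - (0 +i* 1) * A) <=
    rnorm C + rnorm B + rnorm D + rnorm A.
  rewrite (le_trans (rnormD _ _)) // rnormN rnormM rnorm_i mul1r lerD2r.
  rewrite (le_trans (rnormD _ _)) // rnormN lerD2r.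
  by rewrite (le_trans (rnormD _ _)) // rnormM rnorm_i mul1r.
clear; lra.
Qed.

Lemma contour_Im_bound f PH PV (r p M : R) (k : R[i]) : 0 < r ->
  grid_primitives f PH PV r ->
  (forall x, `|x| <= r -> `|complex.Im (k * f (x +i* - r)) - p| <= M) ->
  (forall y, `|y| <= r -> `|complex.Im ((0 +i* 1) * k * f (r +i* y)) - p| <= M) ->
  (forall x, `|x| <= r -> `|complex.Im (- k * f (x +i* r)) - p| <= M) ->
  (forall y, `|y| <= r -> `|complex.Im (- (0 +i* 1) * k * f (- r +i* y)) - p| <= M) ->
  complex.Im (k * contour PH PV (- r) r (- r) r) <= 8 * r * (M + p).
Proof.
move=> r0 [HPH HPV] Hbot Hright Htop Hleft.
have Nrr : - r <= r by lra.
have nr : `|r| <= r by rewrite gtr0_norm.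
have nrN : `|- r| <= r by rewrite normrN gtr0_norm.
have inside x : - r <= x -> x <= r -> `|x| <= r by rewrite ler_norml => -> ->.
have sideH y u : `|y| <= r ->
    (forall x, `|x| <= r -> `|complex.Im (u * f (x +i* y)) - p| <= M) ->
    complex.Im (u * (PH y r - PH y (- r))) <= (M + p) * (r - - r).
  move=> yr Hu; rewrite mulrBr.
  apply: (is_primitive_Im Nrr (is_primitiveZ u (HPH y yr))) => x h1 h2.
  exact: Hu (inside x h1 h2).
have sideV x u : `|x| <= r ->
    (forall y, `|y| <= r -> `|complex.Im (u * f (x +i* y)) - p| <= M) ->
    complex.Im (u * (PV x r - PV x (- r))) <= (M + p) * (r - - r).
  move=> xr Hu; rewrite mulrBr.
  apply: (is_primitive_Im Nrr (is_primitiveZ u (HPV x xr))) => y h1 h2.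
  exact: Hu (inside y h1 h2).
have := sideH _ _ nrN Hbot; have := sideV _ _ nr Hright.
have := sideH _ _ nr Htop; have := sideV _ _ nrN Hleft.
rewrite (_ : k * contour PH PV (- r) r (- r) r = k * (PH (- r) r - PH (- r) (- r)) +
  (0 +i* 1) * k * (PV r r - PV r (- r)) + - k * (PH r r - PH r (- r)) +
  - (0 +i* 1) * k * (PV (- r) r - PV (- r) (- r))); last by rewrite /contour; ring.
set A := k * _; set B := (0 +i* 1) * k * _; set C := - k * _; set E := _ * k * _.
rewrite !raddfD; clear; lra.
Qed.

(** On a side of the square with tangent direction [u], the imaginary part of
    [u / z] is [r / |z| ^ 2], which lies between [1 / (2 * r)] and [1 / r], that
    is, within [1 / (4 * r)] of [3 / (4 * r)]; the part of the kernel that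
    contains [F] is small when [d] is large. *)
Lemma cauchy_kernel_side F d (r rho m : R) u z : 0 < rho -> rho <= r -> 0 < r -> d != 0 ->
  rnorm u = 1 -> rnorm (F z) <= m -> rnorm (F 0) <= m ->
  `|complex.Re z| <= r -> `|complex.Im z| <= r -> r <= rnorm z ->
  sqmod z * complex.Im (u * trunc_inv rho z) = r ->
  `|complex.Im (u * d^-1 * cauchy_kernel F d rho z) - - (3 / (4 * r))| <=
    2 * m / (rnorm d * r ^+ 2) + (4 * r)^-1.
Proof.
move=> rho0 rhor r0 d0 u1 Fz F0 xr yr hr Imu.
have nd0 := rnorm_gt0 d0.
have hq : rho <= rnorm z := le_trans rhor hr.
have zw := trunc_invE rho0 hq.
have wr := rnorm_trunc_inv rho0 hq r0 hr.
set w := trunc_inv rho z in Imu zw wr *.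
have -> : u * d^-1 * cauchy_kernel F d rho z = u / d * (F z - F 0) * w * w - u * w.
  rewrite /cauchy_kernel -/w.
  have -> : (F z - F 0 - d * z) * w * w = (F z - F 0) * w * w - d * (z * w) * w by ring.
  by rewrite zw; field.
rewrite raddfB /=.
have h1 : rnorm (u / d * (F z - F 0) * w * w) <= 2 * m / (rnorm d * r ^+ 2).
  rewrite !rnormM u1 mul1r rnormV //.
  have -> : 2 * m / (rnorm d * r ^+ 2) = (rnorm d)^-1 * (2 * m) * r^-1 * r^-1.
    by field; rewrite !gt_eqF.
  apply: ler_pM; rewrite ?mulr_ge0 ?rnorm_ge0 ?invr_ge0 ?rnorm_ge0 //.
  apply: ler_pM; rewrite ?mulr_ge0 ?rnorm_ge0 ?invr_ge0 ?rnorm_ge0 //.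
  rewrite ler_wpM2l ?invr_ge0 ?rnorm_ge0 // (le_trans (rnormD _ _)) // rnormN.
  by rewrite mulr2n mulrDl mul1r lerD.
have {h1}h1 := le_trans (Im_le_rnorm _) h1.
have s1 : r ^+ 2 <= sqmod z.
  by rewrite sqmod_rnorm ler_sqr ?nnegrE ?rnorm_ge0 // ltW.
have s2 : sqmod z <= 2 * r ^+ 2.
  have sq (x : R) : `|x| <= r -> x ^+ 2 <= r ^+ 2.
    by move=> h; rewrite -(real_normK (num_real x)) ler_sqr ?nnegrE // ltW.
  by rewrite /sqmod mulr2n mulrDl mul1r lerD // sq.
have sp : 0 < sqmod z by apply: lt_le_trans s1; rewrite exprn_gt0.
have h2 : `|complex.Im (u * w) - 3 / (4 * r)| <= (4 * r)^-1.
  have -> : complex.Im (u * w) = r / sqmod z by rewrite -Imu mulrAC divff ?gt_eqF // mul1r.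
  have rs1 : r / sqmod z <= r^-1.
    by rewrite ler_pdivrMr // mulrC ler_pdivlMr // -expr2.
  have rs2 : (2 * r)^-1 <= r / sqmod z.
    rewrite ler_pdivlMr // mulrC ler_pdivrMr ?mulr_gt0 //.
    by have -> : r * (2 * r) = 2 * r ^+ 2 by ring.
  have q1 : 3 / (4 * r) - (4 * r)^-1 = (2 * r)^-1 by field; rewrite gt_eqF.
  have q2 : 3 / (4 * r) + (4 * r)^-1 = r^-1 by field; rewrite gt_eqF.
  by rewrite ler_norml lerBrDr lerBlDr addrC q1 rs2 addrC q2.
rewrite opprK.
set A := complex.Im _; set B := complex.Im _ in h2 *.
have -> : A - B + 3 / (4 * r) = A - (B - 3 / (4 * r)) by ring.
by rewrite (le_trans (ler_normB _ _)) // lerD.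
Qed.

(** As [d] is the derivative at 0, the numerator of the kernel is [o(|z|)], so
    on small squares the kernel is small compared with [1 / |z|]. *)
Lemma cauchy_kernel_small F d (r eta : R) : 0 < r -> 0 < eta -> has_cderiv F 0 d ->
  exists2 q, 0 < q /\ q < r & forall x y, `|x| <= q -> `|y| <= q ->
    q <= `|x| \/ q <= `|y| -> rnorm (cauchy_kernel F d (q / 2) (x +i* y)) <= 2 * eta / q.
Proof.
move=> r0 eta0 Hd.
have [s s0 sP] := Hd _ eta0.
have m0 : 0 < Num.min r (s / 2) by rewrite lt_min r0 divr_gt0.
have m1 : Num.min r (s / 2) <= r by rewrite ge_min lexx.
have m2 : Num.min r (s / 2) <= s / 2 by rewrite ge_min lexx orbT.
pose q := Num.min r (s / 2) / 2.
have q0 : 0 < q by rewrite divr_gt0.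
have qs : 2 * q < s by rewrite /q; lra.
exists q; first by split=> //; rewrite /q; lra.
move=> x y xq yq xy.
have hq : q <= rnorm (x +i* y).
  by case: xy => /le_trans; apply; [exact: (Re_le_rnorm (x +i* y))|exact: (Im_le_rnorm (x +i* y))].
have zr : rnorm (x +i* y) <= 2 * q.
  by rewrite (le_trans (rnorm_le_ReIm _)) // mulr2n mulrDl mul1r lerD.
have := sP (x +i* y); rewrite subr0 => /(_ (le_lt_trans zr qs)) h1.
have q20 : 0 < q / 2 by rewrite divr_gt0.
have q2q : q / 2 <= q by lra.
have wz := rnorm_trunc_inv q20 (le_trans q2q hq) q0 hq.
rewrite /cauchy_kernel !rnormM; apply: (@le_trans _ _ (eta * (2 * q) * q^-1 * q^-1)).
  apply: ler_pM; rewrite ?mulr_ge0 ?rnorm_ge0 //.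
  apply: ler_pM; rewrite ?mulr_ge0 ?rnorm_ge0 //.
  by apply: le_trans h1 _; rewrite ler_wpM2l // ltW.
by rewrite le_eqVlt; apply/orP; left; apply/eqP; field; rewrite gt_eqF.
Qed.

(** The contribution of [- d / z] over the boundary, divided by [d], has imaginary
    part at most [-4] (its exact value is [- 2 * pi]); a crude bound on the sides
    avoids computing it. *)
Lemma cauchy_kernel_contour_Im F d (r rho m : R) PH PV : 0 < rho -> rho <= r -> 0 < r ->
  d != 0 -> (forall x y, `|x| <= r -> `|y| <= r -> rnorm (F (x +i* y)) <= m) ->
  grid_primitives (cauchy_kernel F d rho) PH PV r ->
  complex.Im (d^-1 * contour PH PV (- r) r (- r) r) <= 16 * m / (rnorm d * r) - 4.
Proof.
move=> rho0 rhor r0 d0 Hm HP.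
have nd0 := rnorm_gt0 d0.
have nr : `|r| = r by rewrite gtr0_norm.
have nrN : `|- r| = r by rewrite normrN.
have F0 : rnorm (F 0) <= m by apply: (Hm 0 0); rewrite normr0 ltW.
have wE z : r <= rnorm z ->
    trunc_inv rho z = (complex.Re z / sqmod z) +i* (- complex.Im z / sqmod z).
  move=> hr; rewrite /trunc_inv max_l // sqmod_rnorm ler_sqr ?nnegrE ?rnorm_ge0 ?(ltW rho0) //.
  exact: le_trans hr.
have side u x y : rnorm u = 1 -> `|x| <= r -> `|y| <= r -> `|x| = r \/ `|y| = r ->
    (complex.Im (u * ((x / sqmod (x +i* y)) +i* (- y / sqmod (x +i* y)))) =
      r / sqmod (x +i* y)) ->
    `|complex.Im (u * d^-1 * cauchy_kernel F d rho (x +i* y)) - - (3 / (4 * r))| <=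
    2 * m / (rnorm d * r ^+ 2) + (4 * r)^-1.
  move=> u1 xr yr xyr Hu.
  have zr : r <= rnorm (x +i* y).
    by case: xyr => <-; [exact: (Re_le_rnorm (x +i* y))|exact: (Im_le_rnorm (x +i* y))].
  apply: cauchy_kernel_side => //; first exact: Hm.
  rewrite (wE _ zr) Hu mulrC divfK // sqmod_rnorm expf_neq0 // gt_eqF //.
  exact: lt_le_trans zr.
have := @contour_Im_bound _ PH PV r (- (3 / (4 * r)))
  (2 * m / (rnorm d * r ^+ 2) + (4 * r)^-1) d^-1 r0 HP.
have -> : 8 * r * (2 * m / (rnorm d * r ^+ 2) + (4 * r)^-1 + - (3 / (4 * r))) =
    16 * m / (rnorm d * r) - 4 by field; rewrite !gt_eqF.
apply.
- move=> x xr; rewrite -[d^-1]mul1r; apply: side; rewrite ?rnorm1 ?nrN //; first by right.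
  by rewrite mul1r /= opprK.
- move=> y yr; apply: side; rewrite ?rnorm_i ?nr //; first by left.
  by rewrite /= mul0r mul1r add0r.
- move=> x xr; rewrite -mulN1r; apply: side; rewrite ?rnormN ?rnorm1 ?nr //; first by right.
  by rewrite mulN1r /= mulNr opprK.
move=> y yr; apply: side; rewrite ?rnormN ?rnorm_i ?nrN //; first by left.
by rewrite /= oppr0 mul0r add0r mulNr mul1r mulNr opprK.
Qed.

(** The kernel [(F z - F 0 - d * z) / z ^+ 2] has the same integral over all
    squares centred at 0, and on small squares this integral tends to 0.  Over
    the square of half-side [r] it is at most [16 * m / r] from [F] plus the
    integral of [- d / z], whose size is at least [4 * |d|]; hence the bound. *)
Lemma cauchy_estimate (F : R[i] -> R[i]) (r m : R) (d : R[i]) : 0 < r ->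
  (forall x y, `|x| <= r -> `|y| <= r -> exists D, has_cderiv F (x +i* y) D) ->
  (forall x y, `|x| <= r -> `|y| <= r -> rnorm (F (x +i* y)) <= m) ->
  has_cderiv F 0 d -> rnorm d * r <= 4 * m.
Proof.
move=> r0 HF Hm Hd.
have m0 : 0 <= m.
  by apply: le_trans (Hm 0 0 _ _); rewrite ?rnorm_ge0 // normr0 ltW.
have [->|dn0] := eqVneq d 0; first by rewrite rnorm0 mul0r mulr_ge0.
have nd0 := rnorm_gt0 dn0.
apply/ler_addgt0Pr => eps eps0.
(* The small squares contribute [16 * eta / |d| = 4 * eps / (|d| * r)]. *)
pose eta := eps / (4 * r).
have eta0 : 0 < eta by rewrite divr_gt0 // mulr_gt0.
have [q [q0 qr] Kq] := cauchy_kernel_small r0 eta0 Hd.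
have q20 : 0 < q / 2 by rewrite divr_gt0.
have q2q : q / 2 < q by lra.
have [PH [PV HP]] := cauchy_kernel_grid_primitives d r0 q20 HF.
have annulus : contour PH PV (- r) r (- r) r = contour PH PV (- q) q (- q) q.
  apply: contour_annulus q0 qr HP _ => x y xr yr xy.
  have [D HD] := HF x y xr yr.
  have hq : q <= rnorm (x +i* y).
    by case: xy => /le_trans; apply;
      [exact: (Re_le_rnorm (x +i* y))|exact: (Im_le_rnorm (x +i* y))].
  have Hw := has_cderiv_trunc_inv q20 (lt_le_trans q2q hq).
  have := has_cderivM (has_cderivM (has_cderiv_subaffine (F 0) d HD) Hw) Hw.
  by eexists; eassumption.
have inner := contour_bound q0 (ltW qr) HP Kq.
have e16 : 8 * q * (2 * eta / q) = 16 * eta by field; rewrite gt_eqF.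
rewrite e16 in inner.
have outer := cauchy_kernel_contour_Im q20 (le_trans (ltW q2q) (ltW qr)) r0 dn0 Hm HP.
have low : - ((rnorm d)^-1 * (16 * eta)) <= complex.Im (d^-1 * contour PH PV (- r) r (- r) r).
  rewrite annulus lerNl (le_trans (ler_norm _)) // normrN.
  rewrite (le_trans (Im_le_rnorm _)) // rnormM rnormV //.
  by rewrite ler_wpM2l // invr_ge0 ltW.
have {low outer inner annulus} := le_trans low outer.
have -> : 16 * m / (rnorm d * r) - 4 = (rnorm d * r)^-1 * (16 * m - 4 * (rnorm d * r)).
  by field; rewrite !gt_eqF.
have -> : - ((rnorm d)^-1 * (16 * eta)) = (rnorm d * r)^-1 * (- (4 * eps)).
  by rewrite /eta; field; rewrite !gt_eqF.
rewrite ler_pM2l ?invr_gt0 ?mulr_gt0 //.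
clear -eps0; lra.
Qed.
End Cauchy.

(** * Holomorphic maps are locally Lipschitz *)

Section Lipschitz.
Variable R : realType.

Lemma has_cderiv_line n m (f : 'rV[R[i]]_n -> 'rV[R[i]]_m) (a v : 'rV[R[i]]_n) (z : R[i]) j :
  differentiable f (a + z *: v) ->
  has_cderiv (fun w => f (a + w *: v) 0 j) z ((v *m 'J f (a + z *: v)) 0 j).
Proof.
move=> df e e0.
have v0 : 0 < rnorm v + 1 by rewrite ltr_wpDl ?rnorm_ge0.
have [d d0 dP] := differentiable_rnorm df (divr_gt0 e0 v0).
exists (d / (rnorm v + 1)); first exact: divr_gt0.
move=> w; rewrite ltr_pdivlMr // => wz.
have n0 := rnorm_ge0 (w - z); have nv := rnorm_ge0 v.
have := dP ((w - z) *: v); rewrite rnormZ.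
have -> : rnorm (w - z) * rnorm v < d by nra.
have -> : a + z *: v + (w - z) *: v = a + w *: v.
  by rewrite -addrA -scalerDl [z + _]addrC subrK.
move=> /(_ isT) h.
have := le_trans (rnorm_entry _ j) h.
rewrite -scalemxAl !mxE [_ * \sum_(_ < _) _]mulrC => /le_trans; apply.
have -> : e / (rnorm v + 1) * (rnorm (w - z) * rnorm v) =
    e * rnorm (w - z) * (rnorm v / (rnorm v + 1)) by ring.
rewrite ler_piMr ?mulr_ge0 ?(ltW e0) // ler_pdivrMr //; lra.
Qed.

(** [f] is bounded near [p], being continuous.  On the complex line through two
    nearby points [z] and [w], Cauchy's estimate bounds the derivative at each
    point of the segment by a multiple of [|w - z|], because the line stays in the
    ball where [f] is bounded up to a parameter of order [1 / |w - z|]. *)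
Lemma holomorphic_lipschitz n (D : set 'rV[R[i]]_n) (f : 'rV[R[i]]_n -> 'rV[R[i]]_n) p :
  open D -> holomorphic D f -> D p ->
  exists2 d : R, 0 < d & exists2 L : R, 0 < L &
    (forall z, rnorm (z - p) < d -> D z) /\
    forall z w, rnorm (z - p) < d -> rnorm (w - p) < d ->
      rnorm (f w - f z) <= L * rnorm (w - z).
Proof.
move=> oD hf Dp.
have /nbhs_rnorm[r1 r10 r1P] : nbhs p D by exact: open_nbhs_nbhs.
have [r2 r20 r2P] := rnorm_continuous (hf _ Dp) ltr01.
pose r := Num.min r1 r2.
have r0 : 0 < r by rewrite lt_min r10.
have rD z : rnorm (z - p) < r -> D z.
  by rewrite lt_min => /andP[/r1P].
pose m := 1 + rnorm (f p).
have m0 : 0 < m by rewrite /m ltr_pwDl ?rnorm_ge0.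
have rm z : rnorm (z - p) < r -> rnorm (f z) <= m.
  rewrite lt_min => /andP[_ /r2P h].
  by have := rnorm_triangle (f p) (f z) 0; rewrite !subr0 /m; lra.
exists (r / 4); first by rewrite divr_gt0.
exists (16 * m / r); first by rewrite divr_gt0 // mulr_gt0.
split=> [z h|z w zp wp]; first by apply: rD; lra.
have [->|wz] := eqVneq w z; first by rewrite !subrr !rnorm0 mulr0.
set v := w - z.
have nu0 : 0 < rnorm v by rewrite rnorm_gt0 // subr_eq0.
apply: rnorm_row_le => [|j]; first by rewrite mulr_ge0 ?rnorm_ge0 // divr_ge0 ?mulr_ge0 // ltW.
pose W (t : R) := f (z + t%:C *: v) 0 j.
have segm (t : R) : 0 <= t -> t <= 1 -> rnorm (z + t%:C *: v - p) < r / 4.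
  move=> t0 t1.
  have -> : z + t%:C *: v - p = (1 - t)%:C *: (z - p) + t%:C *: (w - p).
    apply/rowP => k; rewrite !mxE rmorphB /= rmorph1; ring.
  rewrite (le_lt_trans (rnormD _ _)) // !rnormZ !rnormR !ger0_norm ?subr_ge0 //.
  have : Num.max (rnorm (z - p)) (rnorm (w - p)) < r / 4 by rewrite gt_max zp wp.
  apply: le_lt_trans; set c := Num.max _ _.
  have -> : c = (1 - t) * c + t * c by ring.
  by rewrite lerD // ler_wpM2l ?subr_ge0 // le_max lexx ?orbT.
have in_disc (t : R) (u : R[i]) : 0 <= t -> t <= 1 -> rnorm u * rnorm v <= r / 2 ->
    rnorm (z + t%:C *: v + u *: v - p) < r.
  move=> t0 t1 hu; rewrite addrAC (le_lt_trans (rnormD _ _)) // rnormZ.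
  have := segm t t0 t1; lra.
have W1 : W 1 = f w 0 j by rewrite /W scale1r /v addrC subrK.
have W0 : W 0 = f z 0 j by rewrite /W scale0r addr0.
rewrite !mxE -W1 -W0.
have bound t : 0 <= t -> t <= 1 -> exists2 d, has_cderiv (fun u => f (z + u *: v) 0 j) t%:C d
    & rnorm d <= 16 * m / r * rnorm v.
  move=> t0 t1.
  exists ((v *m 'J f (z + t%:C *: v)) 0 j).
    by apply: has_cderiv_line; apply: hf; apply: rD; have := segm t t0 t1; lra.
  pose s := r / (4 * rnorm v).
  have s0 : 0 < s by rewrite divr_gt0 // mulr_gt0.
  have sv (x y : R) : `|x| <= s -> `|y| <= s -> rnorm (x +i* y) * rnorm v <= r / 2.
    move=> xs ys; have -> : r / 2 = 2 * s * rnorm v by rewrite /s; field; rewrite gt_eqF.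
    rewrite ler_wpM2r ?rnorm_ge0 // (le_trans (rnorm_le_ReIm _)) //=; lra.
  have := @cauchy_estimate R (fun u => f (z + t%:C *: v + u *: v) 0 j) s m
    ((v *m 'J f (z + t%:C *: v)) 0 j) s0.
  have -> : 16 * m / r * rnorm v = 4 * m / s.
    by rewrite /s; field; rewrite !gt_eqF.
  rewrite ler_pdivlMr //; apply.
  - move=> x y xs ys; eexists; apply: has_cderiv_line; apply: hf; apply: rD.
    by apply: in_disc => //; exact: sv.
  - move=> x y xs ys; apply: le_trans (rnorm_entry _ j) _; apply: rm.
    by apply: in_disc => //; exact: sv.
  have := @has_cderiv_line n n f (z + t%:C *: v) v 0 j.
  rewrite scale0r addr0; apply; apply: hf; apply: rD.
  by have := segm t t0 t1; lra.
suff dW t : 0 <= t -> t < 1 -> forall e : R, 0 < e -> exists2 d : R, 0 < d &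
    forall s, 0 < s -> s < d ->
      rnorm (W (t + s) - W t) <= (16 * m / r * rnorm v + e) * s.
  have cW : cont_on W 0 1; last first.
    by have := dini_bound cW dW ler01 (lexx 1); rewrite subr0 mulr1.
  move=> s s0 s1 e e0; have [d hd _] := bound s s0 s1.
  have [q q0 qP] := has_cderiv_cont hd e0; exists q => // u _ _ ut.
  by apply: qP; rewrite -rmorphB rnormR.
move=> t0 t1 e e0; have [d hd db] := bound t t0 (ltW t1).
have [q q0 qP] := hd e e0; exists q => // u u0 uq.
have ut : (t + u)%:C - t%:C = u%:C by rewrite -rmorphB addrC addKr.
have := qP (t + u)%:C; rewrite ut rnormR (gtr0_norm u0) => /(_ uq) h.
have -> : W (t + u) - W t = (W (t + u) - W t - d * u%:C) + d * u%:C by rewrite subrK.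
rewrite (le_trans (rnormD _ _)) // rnormM rnormR (gtr0_norm u0).
move: h; rewrite /W; nra.
Qed.
End Lipschitz.

(** * Trajectories of a semigroup *)

Section RightContinuous.
Variables (R : realType) (V : normedZmodType R[i]).

(** Right continuity at the left end of an interval gives an interior subinterval
    on which [u] oscillates by at most twice a prescribed amount.  The common
    point of a nested sequence of such subintervals, with amounts tending to 0,
    is interior to all of them. *)
Lemma right_continuous_has_continuity_point (u : R -> V) (b : R) : 0 < b ->
  (forall t, 0 < t -> forall e : R, 0 < e -> exists2 d : R, 0 < d &
     forall s, 0 <= s -> s < d -> rnorm (u (t + s) - u t) < e) ->
  exists t, [/\ 0 < t, t < b & forall e : R, 0 < e -> exists2 d : R, 0 < d &
     forall s, `|s - t| < d -> rnorm (u s - u t) < e].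
Proof.
move=> b0 Hu.
pose shrink (k : nat) (q q' : R * R) := [/\ q.1 < q'.1, q'.1 < q'.2, q'.2 < q.2 &
  forall s, q'.1 <= s -> s <= q'.2 -> rnorm (u s - u q.1) < k.+1%:R^-1].
have step (kq : nat * (R * R)) : exists q', 0 < kq.2.1 -> kq.2.1 < kq.2.2 ->
    shrink kq.1 kq.2 q'.
  case: kq => k [a c] /=.
  have [[a0 ac]|nac] := pselect (0 < a /\ a < c); last first.
    by exists (a, c) => a0 ac; case: nac.
  have k0 : 0 < k.+1%:R^-1 :> R by rewrite invr_gt0.
  have [d d0 dP] := Hu a a0 _ k0.
  pose h := Num.min d (c - a).
  have h0 : 0 < h by rewrite lt_min d0 subr_gt0.
  have h1 : h <= d by rewrite ge_min lexx.
  have h2 : h <= c - a by rewrite ge_min lexx orbT.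
  exists (a + h / 3, a + h / 2) => _ _; split => /=; try lra.
  move=> s s1 s2; have := dP (s - a); rewrite [a + _]addrC subrK.
  by apply; lra.
have [next nextP] := choice step.
pose fix iv (k : nat) : R * R := if k is k'.+1 then next (k', iv k') else (b / 3, b / 2).
have iv0 k : 0 < (iv k).1 /\ (iv k).1 < (iv k).2.
  elim: k => [|k [IH1 IH2]] /=; first by split; lra.
  have [h1 h2 _ _] := nextP (k, iv k) IH1 IH2.
  by split => //; exact: lt_trans h1.
have ivP k : shrink k (iv k) (iv k.+1).
  by have [h1 h2] := iv0 k; exact: (nextP (k, iv k)).
have [|||p pP] := @nested_point R (fun k => (iv k).1) (fun k => (iv k).2).
- by move=> k; have [/ltW] := ivP k.
- by move=> k; have [_ _ /ltW] := ivP k.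
- by move=> k; have [_ /ltW] := iv0 k.
have [p1 p2] := pP 0; rewrite /= in p1 p2.
exists p; split; [lra|lra|].
move=> e e0.
pose k := Num.bound (2 / e).
have ke : k.+1%:R^-1 < e / 2.
  have h : 2 / e < k%:R by apply: archi_boundP; rewrite divr_ge0 // ltW.
  have {}h : 2 / e < k.+1%:R.
    by apply: lt_le_trans h _; rewrite ler_nat.
  by rewrite -[ltRHS]invrK ltf_pV2 ?posrE ?invr_gt0 ?divr_gt0 // invf_div.
have [a1 _ a2 aP] := ivP k.
have [b1 _ b2 _] := ivP k.+1.
have [q1 q2] := pP k.+2.
exists (Num.min (p - (iv k.+1).1) ((iv k.+1).2 - p)).
  by rewrite lt_min !subr_gt0 (lt_le_trans b1 q1) (le_lt_trans q2 b2).
move=> s; rewrite lt_min => /andP[s1 s2].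
have := ler_norm (s - p); have := ler_norm (- (s - p)); rewrite normrN => s3 s4.
rewrite (le_lt_trans (rnorm_triangle (u (iv k).1) _ _)) //.
have := aP s; have := aP p; have [r1 r2] := pP k.+1.
move=> /(_ r1 r2); rewrite rnormB => h1 h2.
have {}h2 : rnorm (u s - u (iv k).1) < k.+1%:R^-1 by apply: h2; lra.
move: ke h1 h2; set x := _^-1; lra.
Qed.

End RightContinuous.

Section Semigroup.
Variables (R : realType) (n : nat) (D : set 'rV[R[i]]_n).
Hypothesis oD : open D.
Variable phi : R -> 'rV[R[i]]_n -> 'rV[R[i]]_n.
Hypothesis sg : continuous_semigroup D phi.

Lemma flow_in t z : 0 <= t -> D z -> D (phi t z).
Proof. by case: sg => H _ _ t0; have [_] := H t t0; apply. Qed.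

Lemma flow_differentiable t z : 0 <= t -> D z -> differentiable (phi t) z.
Proof. by case: sg => H _ _ t0; have [h _] := H t t0; apply: h. Qed.

Lemma flow_add s t z : 0 <= s -> 0 <= t -> D z -> phi (t + s) z = phi t (phi s z).
Proof. by case: sg => _ H _ s0 t0 Dz; exact: H. Qed.

Lemma flow_lim z : D z -> forall e : R, 0 < e -> exists2 d : R, 0 < d &
  forall t, 0 < t -> t < d -> rnorm (phi t z - z) < e.
Proof. by case: sg => _ _ H Dz; apply: cvg_right0; exact: H. Qed.

(** [phi 0 (phi t z) = phi t z], and both sides have limits as [t] tends to 0, by
    continuity of [phi 0] at [z]. *)
Lemma flow0 z : D z -> phi 0 z = z.
Proof.
move=> Dz; apply/eqP; rewrite -subr_eq0; apply/eqP/rnorm_eq0.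
apply/ler_addgt0Pr => e e0; rewrite add0r.
have e20 : 0 < e / 2 by rewrite divr_gt0.
have [d d0 dP] := rnorm_continuous (flow_differentiable (lexx 0) Dz) e20.
have [d1 d10 d1P] := flow_lim Dz d0; have [d2 d20 d2P] := flow_lim Dz e20.
pose t := Num.min d1 d2 / 2.
have t0 : 0 < t by rewrite divr_gt0 // lt_min d10.
have td1 : t < d1.
  have : Num.min d1 d2 <= d1 by rewrite ge_min lexx.
  by rewrite /t; lra.
have td2 : t < d2.
  have : Num.min d1 d2 <= d2 by rewrite ge_min lexx orbT.
  by rewrite /t; lra.
have := dP _ (d1P _ t0 td1); rewrite -flow_add ?(ltW t0) // add0r => h.
rewrite (le_trans (rnorm_triangle (phi t z) _ _)) // rnormB.
have := d2P _ t0 td2; lra.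
Qed.

Lemma flow_right_cont z t : D z -> 0 <= t -> forall e : R, 0 < e ->
  exists2 d : R, 0 < d & forall s, 0 <= s -> s < d -> rnorm (phi (t + s) z - phi t z) < e.
Proof.
move=> Dz t0 e e0; have [d d0 dP] := flow_lim (flow_in t0 Dz) e0.
exists d => // s; rewrite le_eqVlt => /orP[/eqP <- _|s0 sd].
  by rewrite addr0 subrr rnorm0.
by rewrite [t + s]addrC flow_add ?(ltW s0) //; exact: dP.
Qed.

(** Write [phi s z] as [phi (t - t1) (phi (s - t + t1) z)], where [t1 < t] is a
    continuity point of the trajectory, and use the continuity of
    [phi (t - t1)]. *)
Lemma flow_cont z (T : R) : D z -> cont_on (fun t => phi t z) 0 T.
Proof.
move=> Dz t t0 _ e e0.
have [tpos|] := ltP 0 t; last first.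
  move=> tle; have -> : t = 0 by apply/eqP; rewrite eq_le tle.
  have [d d0 dP] := flow_right_cont Dz (lexx 0) e0.
  exists d => // s s0 _; rewrite subr0 ger0_norm // => sd.
  by have := dP s s0 sd; rewrite add0r.
have [t1 [t10 t1t Ht1]] : exists t1, [/\ 0 < t1, t1 < t & forall e : R, 0 < e ->
    exists2 d : R, 0 < d & forall s, `|s - t1| < d -> rnorm (phi s z - phi t1 z) < e].
  apply: right_continuous_has_continuity_point tpos _ => s s0.
  exact: flow_right_cont Dz (ltW s0).
have tt1 : 0 <= t - t1 by lra.
have [d1 d10 d1P] := rnorm_continuous (flow_differentiable tt1 (flow_in (ltW t10) Dz)) e0.
have [d d0 dP] := Ht1 _ d10.
exists (Num.min d t1); first by rewrite lt_min d0.
move=> s s0 _; rewrite lt_min => /andP[sd st].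
have := ler_norm (- (s - t)); rewrite normrN => st'.
have st1 : 0 <= s - t + t1 by lra.
have es : phi s z = phi (t - t1) (phi (s - t + t1) z).
  by rewrite -flow_add //; congr (phi _ z); ring.
have et : phi t z = phi (t - t1) (phi t1 z).
  by rewrite -flow_add ?(ltW t10) //; congr (phi _ z); ring.
by rewrite es et; apply: d1P; apply: dP; rewrite addrK.
Qed.

Variable f : 'rV[R[i]]_n -> 'rV[R[i]]_n.
Hypothesis gf : generator D phi f.

Lemma flow_right_deriv z t : D z -> 0 <= t -> forall e : R, 0 < e ->
  exists2 d : R, 0 < d & forall s, 0 < s -> s < d ->
    rnorm (phi (t + s) z - phi t z - s%:C *: f (phi t z)) <= e * s.
Proof.
move=> Dz t0 e e0; have Dt := flow_in t0 Dz.
have [d d0 dP] := cvg_right0 (gf.2 _ Dt) e0.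
exists d => // s s0 sd.
have -> : phi (t + s) z = phi s (phi t z) by rewrite addrC flow_add // ltW.
have -> : phi s (phi t z) - phi t z - s%:C *: f (phi t z) =
  s%:C *: (s^-1%:C *: (phi s (phi t z) - phi t z) - f (phi t z)).
  by rewrite scalerBr scalerA -rmorphM divff ?gt_eqF // scale1r.
by rewrite rnormZ rnormR gtr0_norm // mulrC ler_wpM2r ?(ltW s0) // ltW // dP.
Qed.

(** Since [phi (t + s) z = phi t (phi s z)], [phi s z - z = o(s)] and [phi t] is
    Lipschitz at [z], the trajectory has zero right derivative at all times. *)
Lemma flow_fix z : D z -> f z = 0 -> forall t, 0 <= t -> phi t z = z.
Proof.
move=> Dz fz t t0.
suff h : rnorm (phi t z - phi 0 z) <= 0 * (t - 0).
  move: h; rewrite mul0r => /rnorm_eq0/eqP; rewrite subr_eq0 => /eqP ->.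
  exact: flow0.
apply: (dini_bound (@flow_cont z t Dz)) => // {t0}s s0 _ e e0.
have [L L0 [d d0 dP]] := differentiable_lipschitz_at (flow_differentiable s0 Dz).
have eL : 0 < e / L by rewrite divr_gt0.
have [d1 d10 d1P] := flow_right_deriv Dz (lexx 0) eL.
have [d2 d20 d2P] := flow_lim Dz d0.
exists (Num.min d1 d2); first by rewrite lt_min d10.
move=> r r0; rewrite lt_min => /andP[/(d1P r r0) h1 /(d2P r r0) h2].
rewrite add0r flow_add ?(ltW r0) // (le_trans (dP _ h2)) //.
move: h1; rewrite add0r flow0 // fz scaler0 subr0 => h1.
apply: (le_trans (ler_wpM2l (ltW L0) h1)).
by rewrite mulrA [L * _]mulrC divfK ?gt_eqF.
Qed.

(** Two trajectories that start near [p] stay near [p] for short times, where the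
    generator is Lipschitz with constant [L]; so their difference moves with
    speed less than [4 * L * |z - w|] as long as its size is at most
    [3 / 2 * |z - w|].  Both claims are instances of trapping. *)
Lemma flow_near_id p : D p -> exists2 d : R, 0 < d & exists2 tau : R, 0 < tau &
  (forall z, rnorm (z - p) < d -> D z) /\
  forall z w t, rnorm (z - p) < d -> rnorm (w - p) < d -> 0 <= t -> t <= tau ->
    rnorm (phi t z - phi t w - (z - w)) <= 1 / 2 * rnorm (z - w).
Proof.
move=> Dp.
have [d d0 [L L0 [dD dL]]] := holomorphic_lipschitz oD gf.1 Dp.
(* A bound for [f] on the ball, plus 1 to absorb the error of a right derivative. *)
pose M := L * d + rnorm (f p) + 1.
have M0 : 0 < M.
  by rewrite /M; have := rnorm_ge0 (f p); have := mulr_gt0 L0 d0; lra.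
have fM z : rnorm (z - p) < d -> rnorm (f z) <= M - 1.
  move=> zd; have := dL p z; rewrite subrr rnorm0 => /(_ d0 zd) h.
  have := rnorm_triangle (f p) (f z) 0; rewrite !subr0 /M.
  have : L * rnorm (z - p) <= L * d by rewrite ler_wpM2l // ltW.
  lra.
exists (d / 2); first by rewrite divr_gt0.
(* With speed [M] a trajectory moves by at most [d / 4] in this time, and a
   difference of two trajectories with speed [4 * L * |z - w|] by half its size. *)
pose tau := Num.min (d / (4 * M)) ((8 * L)^-1).
have tau0 : 0 < tau by rewrite lt_min !(divr_gt0, invr_gt0, mulr_gt0).
have tauM : M * tau <= d / 4.
  have : tau <= d / (4 * M) by rewrite ge_min lexx.
  by rewrite ler_pdivlMr ?mulr_gt0 //; lra.
have tauL : L * tau <= 1 / 8.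
  have : tau <= (8 * L)^-1 by rewrite ge_min lexx orbT.
  by rewrite -[_^-1]mul1r ler_pdivlMr ?mulr_gt0 //; lra.
exists tau => //; split=> [z h|]; first by apply: dD; lra.
have stay z t : rnorm (z - p) < d / 2 -> 0 <= t -> t <= tau ->
    rnorm (phi t z - p) < d.
  move=> zd t0 tt; have Dz : D z by apply: dD; lra.
  have close s : s <= tau -> rnorm (phi s z - phi 0 z) <= M * (s - 0) ->
      rnorm (phi s z - p) < d.
    rewrite flow0 // subr0 => st h.
    have : M * s <= M * tau by rewrite ler_wpM2l // ltW.
    have := rnorm_triangle z (phi s z) p; lra.
  apply: (close t) => //.
  apply: (@trapping R _ (fun t => phi t z) 0 tau M (@flow_cont z tau Dz)) => //.
  move=> s s0 st h; have hs := close s (ltW st) h.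
  have [r r0 rP] := flow_right_deriv Dz s0 ltr01.
  exists r => // q q0 qr; have := rP q q0 qr.
  have := fM _ hs; set x := phi (s + q) z - phi s z => h1 h2.
  have -> : x = (x - q%:C *: f (phi s z)) + q%:C *: f (phi s z) by rewrite subrK.
  rewrite (le_trans (rnormD _ _)) // rnormZ rnormR (gtr0_norm q0); nra.
move=> z w t zd wd t0 tt.
have Dz : D z by apply: dD; lra.
have Dw : D w by apply: dD; lra.
have [->|zw] := eqVneq z w; first by rewrite !subrr rnorm0 mulr0.
have nzw : 0 < rnorm (z - w) by rewrite rnorm_gt0 // subr_eq0.
pose W t := phi t z - phi t w; pose k := 4 * L * rnorm (z - w).
have cW : cont_on W 0 tau.
  move=> s s0 st e e0; have e20 : 0 < e / 2 by rewrite divr_gt0.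
  have [d1 d10 d1P] := @flow_cont z tau Dz s s0 st _ e20.
  have [d2 d20 d2P] := @flow_cont w tau Dw s s0 st _ e20.
  exists (Num.min d1 d2); first by rewrite lt_min d10.
  move=> q q0 qt; rewrite lt_min => /andP[/(d1P q q0 qt) h1 /(d2P q q0 qt) h2].
  have -> : W q - W s = (phi q z - phi s z) - (phi q w - phi s w).
    by apply/rowP => j; rewrite /W !mxE; ring.
  rewrite (le_lt_trans (rnormD _ _)) // rnormN; lra.
have W0 : W 0 = z - w by rewrite /W !flow0.
have k0 : 0 < k by rewrite !mulr_gt0.
suff h : rnorm (W t - W 0) <= k * (t - 0).
  move: h; rewrite W0 subr0 => /le_trans; apply.
  have : L * t <= 1 / 8 by apply: le_trans tauL; rewrite ler_wpM2l // ltW.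
  rewrite /k; nra.
apply: (trapping cW) => // s s0 st; rewrite W0 subr0 => h.
have Ws : rnorm (W s) <= 3 / 2 * rnorm (z - w).
  have := rnorm_triangle (z - w) (W s) 0; rewrite !subr0.
  have : k * s <= 1 / 2 * rnorm (z - w).
    have : L * s <= 1 / 8 by apply: le_trans tauL; rewrite ler_wpM2l // ltW.
    by rewrite /k; nra.
  lra.
have e0 : 0 < k / 8 by rewrite divr_gt0.
have [r1 r10 r1P] := flow_right_deriv Dz s0 e0.
have [r2 r20 r2P] := flow_right_deriv Dw s0 e0.
exists (Num.min r1 r2); first by rewrite lt_min r10.
move=> q q0; rewrite lt_min => /andP[/(r1P q q0) h1 /(r2P q q0) h2].
have h3 : rnorm (f (phi s z) - f (phi s w)) <= L * rnorm (W s).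
  by apply: dL; apply: stay => //; exact: ltW.
have -> : W (s + q) - W s = (phi (s + q) z - phi s z - q%:C *: f (phi s z)) -
  (phi (s + q) w - phi s w - q%:C *: f (phi s w)) +
  q%:C *: (f (phi s z) - f (phi s w)).
  by apply/rowP => j; rewrite /W !mxE; ring.
rewrite (le_trans (rnormD _ _)) // rnormZ rnormR (gtr0_norm q0).
rewrite (le_trans (lerD (rnormD _ _) (lexx _))) // rnormN.
have h4 : q * rnorm (f (phi s z) - f (phi s w)) <= q * (3 / 8 * k).
  rewrite ler_wpM2l ?(ltW q0) // (le_trans h3) //.
  apply: (le_trans (ler_wpM2l (ltW L0) Ws)).
  by rewrite le_eqVlt; apply/orP; left; apply/eqP; rewrite /k; field.
apply: (le_trans (lerD (lerD h1 h2) h4)).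
have -> : k / 8 * q + k / 8 * q + q * (3 / 8 * k) = 5 / 8 * (k * q) by field.
apply: ler_piMl; first exact: ltW (mulr_gt0 k0 q0).
by rewrite ler_pdivrMr // mul1r ler_nat.
Qed.

End Semigroup.

(** * Linear openness and holomorphic inverses *)

Section LinOpen.
Variable R : realType.

(** Openness at [p] with linear control of the radii.  Unlike plain openness it
    makes a left inverse Lipschitz at [g p], and it is stable under
    composition. *)
Definition linearly_open n (g : 'rV[R[i]]_n -> 'rV[R[i]]_n) p :=
  exists2 c : R, 0 < c & exists2 r0 : R, 0 < r0 & forall r, 0 < r -> r < r0 ->
    forall y, rnorm (y - g p) < c * r -> exists2 z, rnorm (z - p) < r & g z = y.

(** The limit is the common point of the intervals of radius [2 * k / 2 ^+ j]
    around [x j], which are nested. *)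
Lemma geometric_limit_real (x : nat -> R) (k : R) :
  (forall j, `|x j.+1 - x j| <= k / 2 ^+ j) ->
  exists l, forall j, `|l - x j| <= 2 * k / 2 ^+ j.
Proof.
move=> H.
have k0 : 0 <= k by have := le_trans (normr_ge0 _) (H 0); rewrite expr0 divr1.
have half j : 2 * k / 2 ^+ j.+1 = k / 2 ^+ j.
  by rewrite exprS; field; rewrite expf_neq0.
have dbl j : 2 * k / 2 ^+ j = 2 * (k / 2 ^+ j) by rewrite mulrA.
have [|||l lP] := @nested_point R (fun j => x j - 2 * k / 2 ^+ j)
  (fun j => x j + 2 * k / 2 ^+ j).
- by move=> j; have := H j; rewrite half dbl ler_norml => /andP[]; lra.
- by move=> j; have := H j; rewrite half dbl ler_norml => /andP[]; lra.
- move=> j; have : 0 <= 2 * k / 2 ^+ j by rewrite divr_ge0 ?mulr_ge0 ?exprn_ge0.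
  lra.
by exists l => j; have [] := lP j; rewrite ler_norml => h1 h2; apply/andP; split; lra.
Qed.

Lemma geometric_limit n (z : nat -> 'rV[R[i]]_n) (k : R) :
  (forall j, rnorm (z j.+1 - z j) <= k / 2 ^+ j) ->
  exists l, forall j, rnorm (l - z j) <= 4 * k / 2 ^+ j.
Proof.
move=> H.
have k0 : 0 <= k by have := le_trans (rnorm_ge0 _) (H 0); rewrite expr0 divr1.
have entry i : exists l : R[i], forall j, rnorm (l - z j 0 i) <= 4 * k / 2 ^+ j.
  have HC j : rnorm (z j.+1 0 i - z j 0 i) <= k / 2 ^+ j.
    by apply: le_trans (H j); have := rnorm_entry (z j.+1 - z j) i; rewrite !mxE.
  have [j|l1 l1P] := @geometric_limit_real (fun j => complex.Re (z j 0 i)) k.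
    by rewrite -raddfB (le_trans (Re_le_rnorm _)).
  have [j|l2 l2P] := @geometric_limit_real (fun j => complex.Im (z j 0 i)) k.
    by rewrite -raddfB (le_trans (Im_le_rnorm _)).
  exists (l1 +i* l2) => j; rewrite (le_trans (rnorm_le_ReIm _)) //.
  have := l1P j; have := l2P j; case: (z j 0 i) => a b /=.
  have -> : 4 * k / 2 ^+ j = 2 * k / 2 ^+ j + 2 * k / 2 ^+ j by field; rewrite expf_neq0.
  lra.
have [l lP] := choice entry.
exists (\row_i l i) => j; apply: rnorm_row_le => [|i].
  by rewrite divr_ge0 ?mulr_ge0 ?exprn_ge0.
by rewrite !mxE.
Qed.

(** To solve [g z = y], iterate [z |-> z + (y - g z)], which contracts distances
    by 1/2, from the starting point [q]. *)
Lemma linearly_open_near_id n (g : 'rV[R[i]]_n -> 'rV[R[i]]_n) p q (d : R) :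
  (forall z w, rnorm (z - p) < d -> rnorm (w - p) < d ->
    rnorm (g z - g w - (z - w)) <= 1 / 2 * rnorm (z - w)) ->
  rnorm (q - p) < d -> linearly_open g q.
Proof.
(* The steps of the iteration have length at most [|y - g q| / 2 ^+ k], so it
   stays within [2 * |y - g q|] of [q]: the constant 1/4 leaves a margin for the limit. *)
move=> Hg qd; exists (1 / 4) => //.
exists (d - rnorm (q - p)); first by rewrite subr_gt0.
move=> r r0 rd y yq.
have ball z : rnorm (z - q) < r -> rnorm (z - p) < d.
  by move=> zq; have := rnorm_triangle q z p; lra.
pose z := fix z (k : nat) := if k is k'.+1 then z k' + (y - g (z k')) else q.
pose e := rnorm (y - g q).
have e0 : 0 <= e := rnorm_ge0 _.
have er : e < r / 4 by rewrite /e; lra.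
have zP k : rnorm (z k - q) <= 2 * e - 2 * e / 2 ^+ k /\ rnorm (z k.+1 - z k) <= e / 2 ^+ k.
  elim: k => [|k [IH1 IH2]].
    rewrite /= subrr rnorm0 expr0 !divr1 subrr addrAC subrr add0r; split => //.
  have pk : 0 <= e / 2 ^+ k by rewrite divr_ge0 // exprn_ge0.
  have half : 2 * e / 2 ^+ k.+1 = e / 2 ^+ k by rewrite exprS; field; rewrite expf_neq0.
  have dbl : 2 * e / 2 ^+ k = 2 * (e / 2 ^+ k) by rewrite mulrA.
  have zq1 : rnorm (z k.+1 - q) <= 2 * e - e / 2 ^+ k.
    have := rnorm_triangle (z k) (z k.+1) q; lra.
  split; first by rewrite half.
  have hk : rnorm (z k - p) < d by apply: ball; lra.
  have hk1 : rnorm (z k.+1 - p) < d by apply: ball; lra.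
  have -> : z k.+2 - z k.+1 = - (g (z k.+1) - g (z k) - (z k.+1 - z k)).
    by apply/rowP => j; rewrite /= !mxE; ring.
  rewrite rnormN (le_trans (Hg _ _ hk1 hk)) //.
  have -> : e / 2 ^+ k.+1 = 1 / 2 * (e / 2 ^+ k) by rewrite exprS; field; rewrite expf_neq0.
  by rewrite ler_wpM2l.
have [l lP] := geometric_limit (fun k => (zP k).2).
have lq : rnorm (l - q) < r.
  have := lP 2; have [h _] := zP 2; move: h.
  have -> : 4 * e / 2 ^+ 2 = e by field.
  have -> : 2 * e / 2 ^+ 2 = e / 2 by field.
  by have := rnorm_triangle (z 2) l q; lra.
exists l => //; apply/eqP; rewrite -subr_eq0; apply/eqP/rnorm_eq0.
apply/ler_addgt0Pr => eps eps0; rewrite add0r.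
pose k := Num.bound (8 * e / eps).
have small : 8 * e / 2 ^+ k <= eps.
  have : 8 * e / eps < 2 ^+ k by exact: upper_nthrootP (leqnn _).
  by rewrite ltr_pdivrMr // => /ltW h; rewrite ler_pdivrMr ?exprn_gt0 // [eps * _]mulrC.
have [E [E0 E1 E2 E3 E4]] : exists E, [/\ 0 <= E, rnorm (z k - q) <= 2 * e - 2 * E,
    rnorm (z k.+1 - z k) <= E, rnorm (l - z k) <= 4 * E & 8 * E <= eps].
  have [h1 h2] := zP k; exists (e / 2 ^+ k); rewrite !mulrA; split => //.
  by rewrite divr_ge0 // exprn_ge0.
have hk : rnorm (z k - p) < d by apply: ball; clear -E0 E1 er e0; lra.
have h1 := Hg _ _ (ball _ lq) hk.
have -> : g l - y = (g l - g (z k) - (l - z k)) + (l - z k) - (z k.+1 - z k).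
  by apply/rowP => j; rewrite /= !mxE; ring.
rewrite (le_trans (rnormD _ _)) // rnormN.
rewrite (le_trans (lerD (rnormD _ _) (lexx _))) //.
clear -E0 E2 E3 E4 h1; lra.
Qed.

Lemma linearly_open_comp n (g h : 'rV[R[i]]_n -> 'rV[R[i]]_n) p :
  linearly_open g p -> linearly_open h (g p) -> linearly_open (h \o g) p.
Proof.
move=> [c1 c10 [r1 r10 H1]] [c2 c20 [r2 r20 H2]].
exists (c2 * c1); first exact: mulr_gt0.
exists (Num.min r1 (r2 / c1)); first by rewrite lt_min r10 divr_gt0.
move=> r r0; rewrite lt_min ltr_pdivlMr // => /andP[rr1 rr2] y; rewrite -mulrA.
move=> /H2; rewrite mulr_gt0 // mulrC => /(_ isT rr2)[u up <-].
by move: up; rewrite mulrC => /(H1 r r0 rr1)[z zp <-]; exists z.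
Qed.

Lemma linearly_open_ext n (g h : 'rV[R[i]]_n -> 'rV[R[i]]_n) (D : set 'rV[R[i]]_n) p :
  open D -> D p -> (forall z, D z -> g z = h z) -> linearly_open g p -> linearly_open h p.
Proof.
move=> oD Dp gh [c c0 [r1 r10 H]].
have /nbhs_rnorm[d d0 dD] : nbhs p D by exact: open_nbhs_nbhs.
exists c => //; exists (Num.min r1 d); first by rewrite lt_min r10.
move=> r r0; rewrite lt_min => /andP[rr1 rd] y; rewrite -gh // => /(H r r0 rr1)[z zp <-].
by exists z => //; rewrite gh //; apply: dD; exact: lt_trans rd.
Qed.

Lemma linearly_open_mulmx n (B : 'M[R[i]]_n) p : B \in unitmx ->
  linearly_open (fun v => v *m B) p.
Proof.
move=> uB; have [L L0 LP] := rnorm_mulmx (invmx B).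
exists L^-1; first by rewrite invr_gt0.
exists 1 => // r r0 _ y; rewrite mulrC ltr_pdivlMr // => h.
exists (y *m invmx B); last by rewrite mulmxKV.
have -> : y *m invmx B - p = (y - p *m B) *m invmx B by rewrite mulmxBl mulmxK.
by apply: le_lt_trans (LP _) _; rewrite mulrC.
Qed.

Lemma linearly_open_biholomorphic n (D : set 'rV[R[i]]_n) h p :
  biholomorphic D h -> D p -> linearly_open h p.
Proof.
move=> [_ oh [k hk kh]] Dp.
have hDp : (h @` D) (h p) by exists p.
have [L L0 [d d0 dP]] := differentiable_lipschitz_at (hk _ hDp).
have /nbhs_rnorm[d1 d10 d1P] : nbhs (h p) (h @` D) by exact: open_nbhs_nbhs.
exists L^-1; first by rewrite invr_gt0.
exists (L * Num.min d d1); first by rewrite mulr_gt0 // lt_min d0.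
move=> r r0; rewrite mulrC -ltr_pdivrMr // mulrC => rd y yr.
have /d1P[z Dz zy] : rnorm (y - h p) < d1.
  by apply: lt_trans yr (lt_le_trans rd _); rewrite ge_min lexx orbT.
exists z => //; have -> : z - p = k y - k (h p) by rewrite -zy !kh.
have yd : rnorm (y - h p) < d.
  by apply: lt_trans yr (lt_le_trans rd _); rewrite ge_min lexx.
by apply: le_lt_trans (dP _ yd) _; rewrite mulrC -ltr_pdivlMr // mulrC.
Qed.

Section Inverse.
Variables (n : nat) (D : set 'rV[R[i]]_n) (g : 'rV[R[i]]_n -> 'rV[R[i]]_n).
Hypotheses (oD : open D) (hg : holomorphic D g).
Hypothesis ig : forall z w, D z -> D w -> g z = g w -> z = w.
Hypothesis lg : forall p, D p -> linearly_open g p.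

Lemma linearly_open_local p : D p -> exists2 c : R, 0 < c & exists2 r0 : R, 0 < r0 &
  (forall z, rnorm (z - p) < r0 -> D z) /\
  forall r, 0 < r -> r < r0 ->
    forall y, rnorm (y - g p) < c * r -> exists z, [/\ D z, rnorm (z - p) < r & g z = y].
Proof.
move=> Dp; have [c c0 [r1 r10 H]] := lg Dp.
have /nbhs_rnorm[d d0 dD] : nbhs p D by exact: open_nbhs_nbhs.
exists c => //; exists (Num.min r1 d); first by rewrite lt_min r10.
split=> [z|r r0]; rewrite lt_min => /andP[h1 h2]; first exact: dD.
move=> y /(H r r0 h1)[z zp <-]; exists z; split=> //.
by apply: dD; exact: lt_trans h2.
Qed.

(** Were [v] a nonzero vector killed by the derivative, [g (p + s v)] would be
    within [o(s)] of [g p], hence attained at a point within [o(s)] of [p], which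
    is not [p + s v]: this contradicts injectivity. *)
Lemma linearly_open_jacobian_unit p : D p -> 'J g p \in unitmx.
Proof.
move=> Dp; rewrite -row_free_unit -kermx_eq0; apply/negPn/negP => /rowV0Pn[v].
move=> /sub_kermxP vA v0; have nv := rnorm_gt0 v0.
have [c c0 [r1 r10 [rD H]]] := linearly_open_local Dp.
have e0 : 0 < c / 4 by rewrite divr_gt0.
have [d d0 dP] := differentiable_rnorm (hg Dp) e0.
pose s := Num.min r1 d / (2 * rnorm v).
have m0 : 0 < Num.min r1 d by rewrite lt_min r10.
have s0 : 0 < s by rewrite divr_gt0 // mulr_gt0.
have sv : rnorm (s%:C *: v) = Num.min r1 d / 2.
  by rewrite rnormZ rnormR gtr0_norm // /s; field; rewrite gt_eqF.
have m1 : Num.min r1 d <= r1 by rewrite ge_min lexx.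
have m2 : Num.min r1 d <= d by rewrite ge_min lexx orbT.
have svd : rnorm (s%:C *: v) < d by rewrite sv; lra.
have := dP _ svd; rewrite -scalemxAl vA scaler0 subr0 => h.
have r'0 : 0 < rnorm (s%:C *: v) / 2 by rewrite sv !divr_gt0.
have r'1 : rnorm (s%:C *: v) / 2 < r1 by rewrite sv; lra.
have hc : rnorm (g (p + s%:C *: v) - g p) < c * (rnorm (s%:C *: v) / 2).
  apply: le_lt_trans h _; have := mulr_gt0 c0 r'0; lra.
have [z [Dz zp gz]] := H _ r'0 r'1 _ hc.
have Dsv : D (p + s%:C *: v) by apply: rD; rewrite addrC addKr sv; lra.
by move: zp; rewrite (ig Dz Dsv gz) addrC addKr; lra.
Qed.

(** Linear openness bounds [k y - p] by a multiple of [y - g p] for the inverse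
    [k], so the error in the expansion of [g] at [p] is also small compared with
    [y - g p]; inverting the derivative gives the expansion of [k]. *)
Lemma linearly_open_biholo : biholomorphic D g.
Proof.
have og : open (g @` D).
  rewrite openE => _ [p Dp <-]; apply/nbhs_rnorm.
  have [c c0 [r1 r10 [rD H]]] := linearly_open_local Dp.
  have r20 : 0 < r1 / 2 by rewrite divr_gt0.
  have r21 : r1 / 2 < r1 by lra.
  exists (c * (r1 / 2)); first exact: mulr_gt0.
  by move=> y /(H _ r20 r21)[z [Dz _ <-]]; exists z.
split => //.
have inv y : exists z, (g @` D) y -> D z /\ g z = y.
  have [[z Dz zy]|ny] := pselect ((g @` D) y); first by exists z.
  by exists 0.
have [k kP] := choice inv.
have kg z : D z -> k (g z) = z.
  move=> Dz; have [Dk gk] : D (k (g z)) /\ g (k (g z)) = g z by apply: kP; exists z.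
  exact: ig.
exists k => // _ [p Dp <-].
suff [] : differentiable k (g p) /\ 'J k (g p) = invmx ('J g p) by [].
apply: rnorm_differentiable => e e0.
have [c c0 [r1 r10 [rD H]]] := linearly_open_local Dp.
have [L L0 LP] := rnorm_mulmx (invmx ('J g p)).
have uJ := linearly_open_jacobian_unit Dp.
pose e' := e * c / (2 * L).
have e'0 : 0 < e' by rewrite divr_gt0 ?mulr_gt0.
have [d d0 dP] := differentiable_rnorm (hg Dp) e'0.
pose m := Num.min r1 d.
have m0 : 0 < m by rewrite lt_min r10.
exists (c * m / 2); first by rewrite divr_gt0 // mulr_gt0.
move=> v vc; rewrite kg //.
have [->|v0] := eqVneq v 0; first by rewrite addr0 kg // subrr mul0mx subr0 !rnorm0 mulr0.
have nv := rnorm_gt0 v0.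
pose r := 2 * rnorm v / c.
have r0 : 0 < r by rewrite divr_gt0 ?mulr_gt0.
have rm : r < m by rewrite /r ltr_pdivrMr //; lra.
have rr1 : r < r1 by apply: lt_le_trans rm _; rewrite ge_min lexx.
have rd : r < d by apply: lt_le_trans rm _; rewrite ge_min lexx orbT.
have cr : c * r = 2 * rnorm v by rewrite /r; field; rewrite gt_eqF.
have hv : rnorm (g p + v - g p) < c * r by rewrite [g p + v]addrC addrK cr; lra.
have [z [Dz zp gz]] := H r r0 rr1 _ hv.
rewrite -gz kg //.
have := dP (z - p) (lt_trans zp rd); rewrite [p + _]addrC subrK gz.
rewrite [g p + v]addrC addrK => h.
have -> : z - p - v *m invmx ('J g p) = - ((v - (z - p) *m 'J g p) *m invmx ('J g p)).
  by rewrite mulmxBl mulmxK // opprB.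
rewrite rnormN (le_trans (LP _)) //.
apply: (le_trans (ler_wpM2l (ltW L0) h)).
apply: (@le_trans _ _ (L * (e' * r))).
  by rewrite !ler_wpM2l // ltW.
by rewrite /e' /r le_eqVlt; apply/orP; left; apply/eqP; field; rewrite !gt_eqF.
Qed.
End Inverse.
End LinOpen.

Section FlowMaps.
Variables (R : realType) (n : nat) (D : set 'rV[R[i]]_n).
Hypothesis oD : open D.
Variable phi : R -> 'rV[R[i]]_n -> 'rV[R[i]]_n.
Hypothesis sg : continuous_semigroup D phi.
Variable f : 'rV[R[i]]_n -> 'rV[R[i]]_n.
Hypothesis gf : generator D phi f.

Lemma before_time z w t (d tau : R) : D z -> D w -> 0 < t -> 0 < d -> 0 < tau ->
  exists s, [/\ 0 <= s, s < t, t - s <= tau, rnorm (phi s z - phi t z) < d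
    & rnorm (phi s w - phi t w) < d].
Proof.
move=> Dz Dw t0 d0 tau0.
have [d1 d10 d1P] := flow_cont sg Dz (ltW t0) (lexx t) d0.
have [d2 d20 d2P] := flow_cont sg Dw (ltW t0) (lexx t) d0.
pose m := Num.min (Num.min t tau) (Num.min d1 d2).
have m0 : 0 < m by rewrite !lt_min t0 tau0 d10.
have m1 : m <= t by rewrite !ge_min lexx.
have m2 : m <= tau by rewrite !ge_min lexx !orbT.
have m3 : m <= d1 by rewrite !ge_min lexx !orbT.
have m4 : m <= d2 by rewrite !ge_min lexx !orbT.
have hst : `|t - m / 2 - t| = m / 2.
  have -> : t - m / 2 - t = - (m / 2) by ring.
  by rewrite normrN gtr0_norm // divr_gt0.
exists (t - m / 2); split; try lra.
  by apply: d1P; rewrite ?hst; lra.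
by apply: d2P; rewrite ?hst; lra.
Qed.

(** Induction on time: from one time to a slightly later one, the additional map
    is close to the identity near the current point of the trajectory; for the
    step to a limit time [s], the estimate around [phi s p] also covers the
    trajectory just before [s]. *)
Lemma flow_linearly_open p t : D p -> 0 <= t -> linearly_open (phi t) p.
Proof.
move=> Dp t0.
have ext s u q : 0 <= s -> s <= u -> D q -> linearly_open (phi s) q ->
    linearly_open (phi (u - s)) (phi s q) -> linearly_open (phi u) q.
  move=> s0 su Dq h1 h2; apply: (linearly_open_ext oD Dq _ (linearly_open_comp h1 h2)) => z Dz /=.
  by rewrite -(flow_add sg) ?subr_ge0 // subrK.
apply: (@real_induction R (fun t => linearly_open (phi t) p) 0 t) => //.
- apply: (@linearly_open_ext R n idfun _ D p oD Dp); first by move=> z Dz; rewrite (flow0 sg).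
  by exists 1 => //; exists 1 => // r r0 _ y; rewrite mul1r; exists y.
- move=> s s0 st /(_ s s0 (lexx s)) IH.
  have Dq := flow_in sg s0 Dp.
  have [d d0 [tau tau0 [_ H]]] := flow_near_id oD sg gf Dq.
  exists tau => // u su ut; apply: (ext s u) => //; first exact: ltW.
  apply: (@linearly_open_near_id R n _ (phi s p) _ d); last by rewrite subrr rnorm0.
  by move=> z w zd wd; apply: H => //; lra.
move=> s s0 st IH.
have Dq := flow_in sg (ltW s0) Dp.
have [d d0 [tau tau0 [_ H]]] := flow_near_id oD sg gf Dq.
have [u [u0 us ut ud _]] := before_time Dp Dp s0 d0 tau0.
apply: (ext u s) => //; [exact: ltW|exact: IH|].
apply: (@linearly_open_near_id R n _ (phi s p) _ d) => //.
by move=> z w zd wd; apply: H => //; lra.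
Qed.

(** If two trajectories met for the first time at time [s], the flow would fail
    to be injective for short times near the meeting point. *)
Lemma flow_injective t z w : 0 <= t -> D z -> D w -> phi t z = phi t w -> z = w.
Proof.
move=> t0 Dz Dw; apply: contra_eq => /eqP zw; apply/eqP.
apply: (@real_induction R (fun t => phi t z <> phi t w) 0 t) => //.
- by rewrite !(flow0 sg).
- move=> s s0 st /(_ s s0 (lexx s)) IH.
  have /rnorm_gt0 e0 : phi s z - phi s w != 0 by rewrite subr_eq0; apply/eqP.
  have e20 : 0 < rnorm (phi s z - phi s w) / 2 by rewrite divr_gt0.
  have [d1 d10 d1P] := flow_right_cont sg Dz s0 e20.
  have [d2 d20 d2P] := flow_right_cont sg Dw s0 e20.
  exists (Num.min d1 d2); first by rewrite lt_min d10.
  move=> u su ut Hu.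
  have us0 : 0 <= u - s by lra.
  have : u - s < Num.min d1 d2 by lra.
  rewrite lt_min => /andP[/(d1P _ us0) h1 /(d2P _ us0) h2].
  move: h1 h2; rewrite [s + _]addrC subrK Hu rnormB => h1 h2.
  by have := rnorm_triangle (phi u w) (phi s z) (phi s w); lra.
move=> s s0 st IH e.
have Dq := flow_in sg (ltW s0) Dz.
have [d d0 [tau tau0 [_ H]]] := flow_near_id oD sg gf Dq.
have [u [u0 us ut ud1 ud2]] := before_time Dz Dw s0 d0 tau0.
apply: (IH u u0 us).
rewrite -e in ud2.
have su0 : 0 <= s - u by lra.
have := H _ _ _ ud1 ud2 su0 ut.
rewrite -!(flow_add sg) // subrK e subrr sub0r rnormN => h.
apply/eqP; rewrite -subr_eq0; apply/eqP/rnorm_eq0; lra.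
Qed.

End FlowMaps.

(** * Comparison of the two semigroups *)

Section Jacobian.
Variable R : realType.

Lemma jacobian_comp n (f g : 'rV[R[i]]_n -> 'rV[R[i]]_n) z :
  differentiable f z -> differentiable g (f z) ->
  'J (g \o f) z = 'J f z *m 'J g (f z).
Proof.
move=> df dg; apply/row_matrixP => i; rewrite !rowE mulmxA.
have e1 : delta_mx 0 i *m 'J (g \o f) z = 'd (g \o f) z (delta_mx 0 i).
  exact: (mul_rV_lin1 ('d (g \o f) z)).
have e2 : delta_mx 0 i *m 'J f z = 'd f z (delta_mx 0 i).
  exact: (mul_rV_lin1 ('d f z)).
have e3 u : u *m 'J g (f z) = 'd g (f z) u by exact: (mul_rV_lin1 ('d g (f z))).
apply: (etrans e1); apply/esym.
apply: (etrans (congr1 (fun u => u *m 'J g (f z)) e2)); apply: (etrans (e3 _)).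
exact: (congr1 (fun F : 'rV[R[i]]_n -> 'rV[R[i]]_n => F (delta_mx 0 i)) (esym (diff_comp df dg))).
Qed.

Lemma differentiable_mulmx n (B : 'M[R[i]]_n) (z : 'rV[R[i]]_n) :
  differentiable (fun v : 'rV[R[i]]_n => v *m B) z /\
  'J (fun v : 'rV[R[i]]_n => v *m B) z = B.
Proof.
apply: rnorm_differentiable => e e0; exists 1 => // v _.
by rewrite mulmxDl [z *m B + _]addrC addrK subrr rnorm0 mulr_ge0 ?rnorm_ge0 // ltW.
Qed.
End Jacobian.

(** The expansion at 0 with an explicit matrix instead of ['J f 0], for two vector
    fields that share it. *)
Definition has_linear_part (R : realType) n (f : 'rV[R[i]]_n -> 'rV[R[i]]_n)
    (A : 'M[R[i]]_n) := forall e : R, 0 < e -> exists2 d : R, 0 < d &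
  forall v, rnorm v < d -> rnorm (f v - v *m A) <= e * rnorm v.

Lemma jacobian_linear_part (R : realType) n (f : 'rV[R[i]]_n -> 'rV[R[i]]_n) A :
  differentiable f 0 -> f 0 = 0 -> 'J f 0 = A -> has_linear_part f A.
Proof.
move=> df f0 JA e e0; have [d d0 dP] := differentiable_rnorm df e0.
by exists d => // v /dP; rewrite add0r f0 subr0 JA.
Qed.

(** For short times both trajectories from [z] stay of size at most
    [3 / 2 * |z|], where the two vector fields are linear with the same matrix up
    to [o(|z|)].  Their difference therefore starts at 0 with speed [o(|z|)], and
    trapping keeps it [o(|z|)]. *)
Lemma flows_tangent (R : realType) (n : nat) (D : set 'rV[R[i]]_n)
    (phi psi : R -> 'rV[R[i]]_n -> 'rV[R[i]]_n) (f1 f2 : 'rV[R[i]]_n -> 'rV[R[i]]_n)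
    (A : 'M[R[i]]_n) :
  open D -> D 0 -> continuous_semigroup D phi -> continuous_semigroup D psi ->
  generator D phi f1 -> generator D psi f2 -> f1 0 = 0 -> f2 0 = 0 ->
  has_linear_part f1 A -> has_linear_part f2 A ->
  exists2 tau : R, 0 < tau & forall t, 0 <= t -> t <= tau ->
  forall e : R, 0 < e -> exists2 d : R, 0 < d &
    forall z, rnorm z < d -> rnorm (phi t z - psi t z) <= e * rnorm z.
Proof.
move=> oD D0 sphi spsi g1 g2 f10 f20 E1 E2.
have [d1 d10 [t1 t10 [D1 H1]]] := flow_near_id oD sphi g1 D0.
have [d2 d20 [t2 t20 [D2 H2]]] := flow_near_id oD spsi g2 D0.
have [L L0 LP] := rnorm_mulmx A.
pose tau := Num.min (Num.min t1 t2) (Num.min 1 (2 * L)^-1).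
have tau0 : 0 < tau by rewrite !lt_min t10 t20 ltr01 invr_gt0 mulr_gt0.
have tau1 : tau <= t1 by rewrite !ge_min lexx.
have tau2 : tau <= t2 by rewrite !ge_min lexx !orbT.
have tau3 : tau <= 1 by rewrite !ge_min lexx !orbT.
have tau4 : L * tau <= 1 / 2.
  have : tau <= (2 * L)^-1 by rewrite !ge_min lexx !orbT.
  rewrite -[_^-1]mul1r => h.
  rewrite ler_pdivlMr ?mulr_gt0 // in h.
  by lra.
exists tau => // t t0 tt e e0.
(* Each vector field then deviates from its linear part by at most
   [3 / 16 * (e * |z|)] along its trajectory, the linear part of the difference
   contributes at most [1 / 2 * (e * |z|)], and [1 / 8] is left as slack. *)
pose e' := e / 8.
have e'0 : 0 < e' by rewrite divr_gt0.
have [a a0 aP] := E1 _ e'0.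
have [b b0 bP] := E2 _ e'0.
pose d := Num.min (Num.min d1 d2) (Num.min a b / 2).
have ab0 : 0 < Num.min a b by rewrite lt_min a0.
exists d; first by rewrite !lt_min d10 d20 divr_gt0.
move=> z zd.
have [->|z0] := eqVneq z 0.
  by rewrite (flow_fix sphi g1) // (flow_fix spsi g2) // subrr rnorm0 mulr0.
have nz := rnorm_gt0 z0.
have zd1 : rnorm z < d1 by apply: lt_le_trans zd _; rewrite !ge_min lexx.
have zd2 : rnorm z < d2 by apply: lt_le_trans zd _; rewrite !ge_min lexx !orbT.
have zab : rnorm z < Num.min a b / 2 by apply: lt_le_trans zd _; rewrite ge_min lexx orbT.
have ma : Num.min a b <= a by rewrite ge_min lexx.
have mb : Num.min a b <= b by rewrite ge_min lexx orbT.
have Dz : D z by apply: D1; rewrite subr0.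
have B1 s : 0 <= s -> s <= tau -> rnorm (phi s z) <= 3 / 2 * rnorm z.
  move=> s0 st; have := H1 z 0 s; rewrite !subr0 rnorm0 (flow_fix sphi g1 D0 f10 s0) subr0.
  move=> /(_ zd1 d10 s0 (le_trans st tau1)).
  have := rnorm_triangle z (phi s z) 0; rewrite !subr0; lra.
have B2 s : 0 <= s -> s <= tau -> rnorm (psi s z) <= 3 / 2 * rnorm z.
  move=> s0 st; have := H2 z 0 s; rewrite !subr0 rnorm0 (flow_fix spsi g2 D0 f20 s0) subr0.
  move=> /(_ zd2 d20 s0 (le_trans st tau2)).
  have := rnorm_triangle z (psi s z) 0; rewrite !subr0; lra.
pose W s := phi s z - psi s z; pose k := e * rnorm z.
have k0 : 0 < k by rewrite mulr_gt0.
have W0 : W 0 = 0 by rewrite /W (flow0 sphi) // (flow0 spsi) // subrr.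
have cW : cont_on W 0 tau.
  move=> s s0 st q q0; have q20 : 0 < q / 2 by rewrite divr_gt0.
  have [u1 u10 u1P] := flow_cont sphi Dz s0 st q20.
  have [u2 u20 u2P] := flow_cont spsi Dz s0 st q20.
  exists (Num.min u1 u2); first by rewrite lt_min u10.
  move=> r r0 rt; rewrite lt_min => /andP[/(u1P r r0 rt) h1 /(u2P r r0 rt) h2].
  have -> : W r - W s = (phi r z - phi s z) - (psi r z - psi s z).
    by apply/rowP => j; rewrite /W !mxE; ring.
  rewrite (le_lt_trans (rnormD _ _)) // rnormN; clear -h1 h2; lra.
suff h : rnorm (W t - W 0) <= k * (t - 0).
  move: h; rewrite W0 !subr0 => /le_trans; apply.
  by rewrite -/k ler_piMr ?(ltW k0) // (le_trans tt).
apply: (trapping cW) => // s s0 st; rewrite W0 !subr0 => hW.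
have q0 : 0 < k / 32 by rewrite divr_gt0.
have [u1 u10 u1P] := flow_right_deriv sphi g1 Dz s0 q0.
have [u2 u20 u2P] := flow_right_deriv spsi g2 Dz s0 q0.
exists (Num.min u1 u2); first by rewrite lt_min u10.
move=> r r0; rewrite lt_min => /andP[/(u1P r r0) h1 /(u2P r r0) h2].
have b1 := B1 s s0 (ltW st); have b2 := B2 s s0 (ltW st).
have h3 : rnorm (f1 (phi s z) - phi s z *m A) <= 3 / 16 * k.
  have := aP (phi s z) => h.
  apply: le_trans (h _) _; first by clear -b1 zab ma ab0; lra.
  apply: (le_trans (ler_wpM2l (ltW e'0) b1)).
  by rewrite le_eqVlt; apply/orP; left; apply/eqP; rewrite /e' /k; field.
have h4 : rnorm (f2 (psi s z) - psi s z *m A) <= 3 / 16 * k.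
  have := bP (psi s z) => h.
  apply: le_trans (h _) _; first by clear -b2 zab mb ab0; lra.
  apply: (le_trans (ler_wpM2l (ltW e'0) b2)).
  by rewrite le_eqVlt; apply/orP; left; apply/eqP; rewrite /e' /k; field.
have h5 : rnorm (W s *m A) <= 1 / 2 * k.
  apply: le_trans (LP _) _; apply: (le_trans (ler_wpM2l (ltW L0) hW)).
  have : L * s <= 1 / 2 by apply: le_trans tau4; rewrite ler_wpM2l // ltW.
  have := ltW k0; clear -k0; nra.
have -> : W (s + r) - W s = (phi (s + r) z - phi s z - r%:C *: f1 (phi s z)) -
    (psi (s + r) z - psi s z - r%:C *: f2 (psi s z)) +
    r%:C *: ((f1 (phi s z) - phi s z *m A) - (f2 (psi s z) - psi s z *m A)
      + W s *m A).
  rewrite /W mulmxBl; set PA := phi s z *m _; set PB := psi s z *m _.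
  by apply/rowP => j; rewrite !mxE; ring.
rewrite (le_trans (rnormD _ _)) // rnormZ rnormR (gtr0_norm r0).
rewrite (le_trans (lerD (rnormD _ _) (lexx _))) // rnormN.
have h6 : r * rnorm ((f1 (phi s z) - phi s z *m A) -
    (f2 (psi s z) - psi s z *m A) + W s *m A) <= r * (7 / 8 * k).
  rewrite ler_wpM2l ?(ltW r0) // (le_trans (rnormD _ _)) //.
  rewrite (le_trans (lerD (rnormD _ _) (lexx _))) // rnormN; clear -h3 h4 h5; lra.
have := mulr_gt0 k0 r0; clear -h1 h2 h6; lra.
Qed.

Lemma flows_same_jacobian (R : realType) (n : nat) (D : set 'rV[R[i]]_n)
    (phi psi : R -> 'rV[R[i]]_n -> 'rV[R[i]]_n) (f1 f2 : 'rV[R[i]]_n -> 'rV[R[i]]_n)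
    (A : 'M[R[i]]_n) :
  open D -> D 0 -> continuous_semigroup D phi -> continuous_semigroup D psi ->
  generator D phi f1 -> generator D psi f2 -> f1 0 = 0 -> f2 0 = 0 ->
  has_linear_part f1 A -> has_linear_part f2 A ->
  exists2 tau : R, 0 < tau & forall t, 0 <= t -> t <= tau -> 'J (phi t) 0 = 'J (psi t) 0.
Proof.
move=> oD D0 sphi spsi g1 g2 f10 f20 E1 E2.
have [tau tau0 H] := flows_tangent oD D0 sphi spsi g1 g2 f10 f20 E1 E2.
exists tau; first exact: tau0.
move=> t t0 tt; apply: (proj2 (A := differentiable (phi t) 0)).
apply: rnorm_differentiable => e e0; have e20 : 0 < e / 2 by rewrite divr_gt0.
have [d1 d10 d1P] := H t t0 tt _ e20.
have [d2 d20 d2P] := differentiable_rnorm (flow_differentiable spsi t0 D0) e20.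
exists (Num.min d1 d2); first by rewrite lt_min d10.
move=> v; rewrite lt_min => /andP[/d1P h1 /d2P].
rewrite (flow_fix sphi g1 D0 f10 t0) (flow_fix spsi g2 D0 f20 t0) add0r !subr0 => h2.
have -> : phi t v - v *m 'J (psi t) 0 = (phi t v - psi t v) + (psi t v - v *m 'J (psi t) 0).
  by rewrite addrA subrK.
rewrite (le_trans (rnormD _ _)) //; lra.
Qed.

Section Linearization.
Variables (R : realType) (n : nat) (D : set 'rV[R[i]]_n).
Hypotheses (oD : open D) (D0 : D 0).
Variable phi : R -> 'rV[R[i]]_n -> 'rV[R[i]]_n.
Hypothesis sg : continuous_semigroup D phi.
Variable f : 'rV[R[i]]_n -> 'rV[R[i]]_n.
Hypotheses (gf : generator D phi f) (f0 : f 0 = 0).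

(** [h'] conjugates [g] to [M *m B *m invmx M] because [phi t] commutes with [g],
    and it is normalized by the chain rule, so uniqueness identifies it with
    [h]. *)
Lemma linearizes_commuting_flow (g h : 'rV[R[i]]_n -> 'rV[R[i]]_n) :
  (forall z, D z -> D (g z)) ->
  (forall t, 0 <= t -> forall z, D z -> g (phi t z) = phi t (g z)) ->
  normalized_linearization D g h ->
  (forall h', normalized_linearization D g h' -> forall z, D z -> h' z = h z) ->
  forall t, 0 <= t -> forall z, D z -> h (phi t z) = h z *m 'J (phi t) 0.
Proof.
move=> gD comm lh uniq t t0 z Dz.
have [bh _ _ _] := lh.
set M := 'J (phi t) 0.
have inj := @flow_injective R n D oD phi sg f gf t.
have hphi w : D w -> differentiable (phi t) w by exact: (flow_differentiable sg).
have uM : M \in unitmx.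
  apply: (linearly_open_jacobian_unit oD hphi) => //.
    by move=> w1 w2; exact: inj.
  by move=> p Dp; exact: (flow_linearly_open oD sg gf).
pose h' w := h (phi t w) *m invmx M.
have uMi : invmx M \in unitmx by rewrite unitmx_inv.
have dh w : D w -> differentiable h (phi t w).
  by move=> Dw; case: bh => hh _ _; apply: hh; exact: (flow_in sg).
have dhphi w : D w -> differentiable (h \o phi t) w.
  by move=> Dw; apply: differentiable_comp; [exact: hphi|exact: dh].
have dh' w : D w -> differentiable h' w.
  move=> Dw; apply: (@differentiable_comp _ _ _ _ (h \o phi t) (fun v => v *m invmx M)).
    exact: dhphi.
  exact: (differentiable_mulmx _ _).1.
have lin : normalized_linearization D g h'.
  have [_ h0 _ [B hB]] := lh.
  split.
  - apply: linearly_open_biholo => //.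
      move=> w1 w2 Dw1 Dw2 /(congr1 (mulmx^~ M)); rewrite /h' !mulmxKV //.
      case: bh => _ _ [k _ kh] /(congr1 k); rewrite !kh; try exact: (flow_in sg).
      exact: inj.
    move=> p Dp.
    apply: (@linearly_open_comp R n (h \o phi t) (fun v => v *m invmx M));
      last exact: linearly_open_mulmx.
    apply: linearly_open_comp; first exact: (flow_linearly_open oD sg gf).
    by apply: (linearly_open_biholomorphic bh); exact: (flow_in sg).
  - by rewrite /h' (flow_fix sg gf D0 f0 t0) h0 mul0mx.
  - have -> : h' = (fun v => v *m invmx M) \o (h \o phi t) by [].
    rewrite jacobian_comp; [|exact: dhphi|exact: (differentiable_mulmx _ _).1].
    rewrite jacobian_comp; [|exact: hphi|exact: dh].
    rewrite (differentiable_mulmx _ _).2 (flow_fix sg gf D0 f0 t0).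
    have [_ _ -> _] := lh.
    by rewrite mulmx1 mulmxV.
  exists (M *m B *m invmx M) => w Dw.
  have Dphi : D (phi t w) by exact: (flow_in sg).
  have e : h (phi t (g w)) = h (phi t w) *m B.
    by rewrite -(comm t t0 w Dw) (hB _ Dphi).
  by rewrite /h' e 2!mulmxA mulmxKV.
by rewrite -(uniq _ lin z Dz) /h' mulmxKV.
Qed.
End Linearization.

Theorem corollary2 (R : realType) (n : nat) (hn : (0 < n)%N)
    (D : set 'rV[R[i]]_n) (hD : domain D) (hD0 : D 0)
    (phi psi : R -> 'rV[R[i]]_n -> 'rV[R[i]]_n)
    (hphi : continuous_semigroup D phi) (hpsi : continuous_semigroup D psi)
    (f1 f2 : 'rV[R[i]]_n -> 'rV[R[i]]_n)
    (hf1 : generator D phi f1) (hf2 : generator D psi f2)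
    (hf10 : f1 0 = 0) (hf20 : f2 0 = 0)
    (A : 'M[R[i]]_n) (hA1 : 'J f1 0 = A) (hA2 : 'J f2 0 = A)
    (hA : forall lambda : R[i], eigenvalue A lambda -> complex.Re lambda < 0)
    (s0 : R) (hs0 : 0 < s0)
    (hlin : uniquely_linearizable D (psi s0))
    (hcomm : forall t : R, 0 <= t ->
       forall z, D z -> psi s0 (phi t z) = phi t (psi s0 z)) :
  forall t : R, 0 <= t -> forall z, D z -> phi t z = psi t z.
Proof.
have [oD _ _] := hD.
have E1 := jacobian_linear_part (hf1.1 _ hD0) hf10 hA1.
have E2 := jacobian_linear_part (hf2.1 _ hD0) hf20 hA2.
clear hA hA1 hA2.
have [tau tau0 same] := flows_same_jacobian oD hD0 hphi hpsi hf1 hf2 hf10 hf20 E1 E2.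
have [h [hh hu]] := hlin.
have s00 := ltW hs0.
have gD z : D z -> D (psi s0 z) by exact: (flow_in hpsi).
have lphi := linearizes_commuting_flow oD hD0 hphi hf1 hf10 gD hcomm hh hu.
have psicomm t : 0 <= t -> forall z, D z -> psi s0 (psi t z) = psi t (psi s0 z).
  by move=> t0 z Dz; rewrite -!(flow_add hpsi) // addrC.
have lpsi := linearizes_commuting_flow oD hD0 hpsi hf2 hf20 gD psicomm hh hu.
have small t : 0 <= t -> t <= tau -> forall z, D z -> phi t z = psi t z.
  move=> t0 tt z Dz; have [[_ _ [k _ kh]] _ _ _] := hh.
  have eqh : h (phi t z) = h (psi t z).
    apply: (etrans (lphi t t0 z Dz)); apply: (etrans _ (esym (lpsi t t0 z Dz))).
    exact: (congr1 (mulmx (h z)) (same t t0 tt)).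
  rewrite -(kh _ (flow_in hphi t0 Dz)) -(kh _ (flow_in hpsi t0 Dz)).
  exact: (congr1 k eqh).
move=> t t0 z Dz.
(* Cut [0, t] into N equal steps of length at most [tau]. *)
pose N := (Num.bound (t / tau)).+1.
have N0 : 0 < N%:R :> R by rewrite ltr0n.
have sN : t / N%:R <= tau.
  have : t / tau < (Num.bound (t / tau))%:R by apply: archi_boundP; rewrite divr_ge0 // ltW.
  rewrite ltr_pdivrMr // => hN; rewrite ler_pdivrMr // mulrC.
  by apply: le_trans (ltW hN) _; rewrite ler_wpM2r ?(ltW tau0) // ler_nat.
have s_ge0 : 0 <= t / N%:R by rewrite divr_ge0 // ltW.
have steps k : phi (t / N%:R *+ k) z = psi (t / N%:R *+ k) z.
  elim: k => [|k IH]; first by rewrite mulr0n (flow0 hphi) // (flow0 hpsi).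
  have k0 : 0 <= t / N%:R *+ k by rewrite mulrn_wge0.
  rewrite mulrS (flow_add hphi) // (flow_add hpsi) // IH small //.
  exact: (flow_in hpsi).
have := steps N; rewrite -mulr_natr divfK ?gt_eqF //.
Qed.
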